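(* Let $n,p,q$ be positive integers with $p\ge 2$, let $\gamma$ be a real, and let $\epsilon_1>0$. Let $C\ge\sigma^2_{\max}\lambda_{\max}$, $\kappa=\log_n p$ and $\gamma_0=\gamma-\left(1-\frac{1}{4\kappa}\right)$. Suppose $$\frac{(p+2q)\log p}{n}\cdot\frac{\lambda_{\max}^2}{\theta_0^2}\le\frac{1}{3200\max\{1+\gamma_0,(1+\frac{\epsilon_1}{2})C^2\}}.$$ Then with probability at least $1-\frac{1}{\sqrt{\pi\log p}}p^{-\epsilon_1}$, for all edge sets $\mathbf{E}$ on the $p$ nodes with $\mathbf{E}\not\supset\mathbf{E}_0$ and $|\mathbf{E}|\le q$, $$l_n(\Theta_0)-l_n(\hat\Theta(\mathbf{E}))>2q(\log p)(1+\gamma_0).$$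
   Context: An edge set $\mathbf{E}$ on $p$ nodes is a set of unordered pairs $\{j,k\}$ of distinct elements of $\{1,\dots,p\}$; it is identified with the Gaussian graphical model of all zero-mean normal distributions $N(0,\Theta^{-1})$ with $\Theta$ positive definite and $\Theta_{jk}=0$ whenever $j\neq k$ and $\{j,k\}\notin\mathbf{E}$. Let $\mathbf{E}_0$ be an edge set and $\Theta_0$ a $p\times p$ positive definite matrix whose nonzero entries are exactly the diagonal entries and the entries $(j,k),(k,j)$ for $\{j,k\}\in\mathbf{E}_0$. Let $X_1,\dots,X_n$ be i.i.d. $N(0,\Theta_0^{-1})$, $S=\frac1n\sum_i X_iX_i^T$, and $l_n(\Theta)=\frac n2[\log\det\Theta-\mathrm{trace}(S\Theta)]$. $\hat\Theta(\mathbf{E})$ denotes the maximum likelihood estimator of $\Theta$ in the model $\mathbf{E}$. Further, $\sigma^2_{\max}=\max_j(\Theta_0^{-1})_{jj}$, $\theta_0=\min_{\{j,k\}\in\mathbf{E}_0}|(\Theta_0)_{jk}|$, and $\lambda_{\max}$ is the largest eigenvalue of $\Theta_0$. *)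

(* Defs.v *)
From HB Require Import structures.
From mathcomp Require Import all_boot all_order all_algebra.
From mathcomp Require Import all_classical all_reals all_analysis.
Set Implicit Arguments. Unset Strict Implicit. Unset Printing Implicit Defensive.
Import Order.TTheory GRing.Theory Num.Theory.
Local Open Scope classical_set_scope.
Local Open Scope ring_scope.

Definition edge_set (p : nat) (E : {set {set 'I_p}}) : Prop :=
  forall e, e \in E -> #|e| = 2%N.

Definition posdef (R : realType) (p : nat) (A : 'M[R]_p) : Prop :=
  A^T = A /\ forall x : 'cV[R]_p, x != 0 -> 0 < (x^T *m A *m x) ord0 ord0.

(* The Gaussian graphical model of the edge set E (as a set of precision
   matrices Theta). *)
Definition in_model (R : realType) (p : nat) (E : {set {set 'I_p}})
  (Theta : 'M[R]_p) : Prop :=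
  posdef Theta /\
  forall j k : 'I_p, j != k -> [set j; k]%SET \notin E -> Theta j k = 0.

Definition support_is (R : realType) (p : nat) (E0 : {set {set 'I_p}})
  (Theta0 : 'M[R]_p) : Prop :=
  (forall j : 'I_p, Theta0 j j != 0) /\
  forall j k : 'I_p, j != k -> (Theta0 j k != 0 <-> [set j; k]%SET \in E0).

Definition sample_vec (R : realType) (T : Type) (n p : nat)
  (X : 'I_n -> 'I_p -> T -> R) (i : 'I_n) (t : T) : 'cV[R]_p :=
  \col_k X i k t.

Definition sample_cov (R : realType) (T : Type) (n p : nat)
  (X : 'I_n -> 'I_p -> T -> R) (t : T) : 'M[R]_p :=
  n%:R^-1 *: \sum_(i < n) (sample_vec X i t *m (sample_vec X i t)^T).

Definition loglik (R : realType) (T : Type) (n p : nat)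
  (X : 'I_n -> 'I_p -> T -> R) (t : T) (Theta : 'M[R]_p) : R :=
  n%:R / 2 * (ln (\det Theta) - \tr (sample_cov X t *m Theta)).

(* Maximized log-likelihood over the model E, l_n(hat Theta(E)), as a
   supremum in the extended reals (equal to the value at the MLE when
   the MLE exists). *)
Definition max_loglik (R : realType) (T : Type) (n p : nat)
  (X : 'I_n -> 'I_p -> T -> R) (t : T) (E : {set {set 'I_p}}) : \bar R :=
  ereal_sup ((fun Theta => (loglik X t Theta)%:E) @` [set Theta | in_model E Theta]).

(* X_1, ..., X_n are i.i.d. N(0, Sigma) random vectors in R^p, where X i k
   is the k-th coordinate of X_(i+1):
   - every coordinate is a measurable (real random variable);
   - the n random vectors are mutually independent (product rule on
     measurable boxes, which generate the Borel sigma-algebra of R^p);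
   - each X_i is N(0, Sigma): every nonzero linear combination a^T X_i
     is normal with mean 0 and variance a^T Sigma a. *)
Definition iid_gaussian (R : realType) (d : measure_display)
  (T : measurableType d) (P : probability T R) (n p : nat)
  (Sigma : 'M[R]_p) (X : 'I_n -> 'I_p -> T -> R) : Prop :=
  [/\ (forall i k, measurable_fun setT (X i k)),
      (forall B : 'I_n -> 'I_p -> set R, (forall i k, measurable (B i k)) ->
         P (\bigcap_(i in [set: 'I_n]) [set t | forall k, B i k (X i k t)])
         = (\prod_(i < n) P [set t | forall k, B i k (X i k t)])%E) &
      (forall (i : 'I_n) (a : 'cV[R]_p), a != 0 ->
         forall B : set R, measurable B ->
         P [set t | B ((a^T *m sample_vec X i t) ord0 ord0)]
         = normal_prob 0 (Num.sqrt ((a^T *m Sigma *m a) ord0 ord0)) B)].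

Definition sigma2max (R : realType) (p : nat) (Theta0 : 'M[R]_p) : R :=
  \big[Num.max/0]_(j < p) (invmx Theta0) j j.

(* Main.v *)
(** Choose [B] with [B^T Theta0 B = 1] and measure a symmetric matrix [M] by the
    Frobenius norm of [B^T M B].  Along a ray leaving [Theta0] the divergence
    [sum (d_i - ln (1 + d_i))] is convex, so the likelihood deficit of [Theta] in the
    model [E] is bounded below by its value where the ray crosses the sphere of radius
    [r = sqrt 2 theta0 / lmax], which it must cross because an edge of [E0] is missing
    from [E].  There the divergence is at least [r^2 / 4], and what remains is to show
    that the noise [tr ((S - Sigma) (Theta - Theta0))] is at most [r / 5] times the norm.

    The cardinality of [E0] is not bounded, so [Theta - Theta0] need not be sparse.
    Let [N] be the orthogonal projection of [Theta0] on the symmetric matrices supported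
    by [E] and the diagonal.  [Theta - N] has at most [p + 2q] nonzero entries and is
    controlled by the entrywise deviations of [S]; [Theta0 - N] depends on [E] only, and
    a union bound over the at most [p^(2q)] sets [E] controls its deviation.

    For these deviations one needs the exponential moments of [Z^T M Z] with [M] indefinite,
    while normality of [X] is only known through its linear combinations.  Split
    [M] into positive and negative parts; for [A >= 0], [exp (Z^T A Z / 2)] and
    [exp (- Z^T A Z / 2)] are Gaussian averages of exponentials and of cosines of linear
    combinations of [Z]. *)

Require Import Defs.
From HB Require Import structures.
From mathcomp Require Import all_boot all_order all_algebra.
From mathcomp Require Import all_classical all_reals all_analysis.
From mathcomp Require Import measurable_realfun ring lra complex.
Set Implicit Arguments. Unset Strict Implicit. Unset Printing Implicit Defensive.
Import Order.TTheory GRing.Theory Num.Theory.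
Import numFieldNormedType.Exports.
Local Open Scope classical_set_scope.
Local Open Scope ring_scope.

(** * Real symmetric matrices *)

Section LinearAlgebra.
Variable R : realType.

(** Deviations of two kinds are needed because entrywise bounds alone would cost the number of
    nonzero entries of [Theta - Theta0], which grows with [E0]. The residual [Theta0 - N] may be
    dense, but it is deterministic once [E] is fixed, so one scalar tail bound that sees only its
    norm suffices. The split at [N] is orthogonal for the whitened inner product, which lets
    Cauchy-Schwarz combine both contributions against the norm of the whole difference. The radius
    [r] must be at most 3/4, the range where [x - ln (1 + x)] is bounded below by [x ^ 2 / 4]. This
    holds because an off-diagonal entry of a positive definite matrix is at most half its largest
    eigenvalue. At the sphere [r ^ 2 / 4 - r ^ 2 / 5 = theta0 ^ 2 / (10 lmax ^ 2)], and half of [n]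
    times this exceeds the target by a wide margin. The constant 3200 is spent on the noise: its
    squared level comes out as at most 232/3200 of [theta0 ^ 2 / lmax ^ 2], and 2/25 is allowed. *)

Definition frob m n (A : 'M[R]_(m, n)) : R := \sum_i \sum_j A i j ^+ 2.

Lemma frobE m n (A : 'M[R]_(m, n)) : frob A = \tr (A *m A^T).
Proof.
apply: eq_bigr => i _; rewrite mxE; apply: eq_bigr => j _.
by rewrite mxE expr2.
Qed.

Lemma frob_ge0 m n (A : 'M[R]_(m, n)) : 0 <= frob A.
Proof. by apply: sumr_ge0 => i _; apply: sumr_ge0 => j _; rewrite sqr_ge0. Qed.

Lemma frob_eq0 m n (A : 'M[R]_(m, n)) : frob A = 0 -> A = 0.
Proof.
move=> /eqP; rewrite psumr_eq0; last first.
  by move=> i _; apply: sumr_ge0 => j _; rewrite sqr_ge0.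
move=> /allP A0; apply/matrixP => i j; rewrite mxE.
have := A0 i (mem_index_enum _); rewrite psumr_eq0 => [/allP/(_ j)|k _].
  by rewrite mem_index_enum sqrf_eq0 => /(_ isT)/eqP.
by rewrite sqr_ge0.
Qed.

Lemma rV_dotE n (v : 'rV[R]_n) : v *m v^T = (frob v)%:M.
Proof.
rewrite frobE [LHS]mx11_scalar; congr _%:M.
by rewrite /mxtrace big_ord_recl big_ord0 addr0.
Qed.

Lemma rV_dot_eq0 n (v : 'rV[R]_n) : v *m v^T = 0 -> v = 0.
Proof.
rewrite rV_dotE => /matrixP/(_ 0 0); rewrite !mxE eqxx mulr1n; exact: frob_eq0.
Qed.

(** Over the algebraically closed field [R[i]] an eigenvector [v] exists; computing [v A v^*] in two
    ways gives [z = z^*]. The real eigenvalue is then brought back to [R] through the characteristic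
    polynomial. *)
Lemma symmetric_eigenvalue n (A : 'M[R]_n.+1) : A^T = A ->
  exists a : R, eigenvalue A a.
Proof.
move=> As; pose C := R[i]; pose f : {rmorphism R -> C} := real_complex R.
have [z zA] := @eigenvalue_closed C n.+1 (map_mx f A) isT.
have /eigenvalueP[v vA v0] := zA.
pose vc := map_mx (@Num.conj C) v.
have Ac : map_mx (@Num.conj C) (map_mx f A) = map_mx f A.
  by apply/matrixP => i j; rewrite !mxE; apply/eqP; rewrite eq_complex /= oppr0 !eqxx.
have vcA : vc *m map_mx f A = (z^* )%C *: vc.
  by rewrite -[in LHS]Ac -map_mxM vA map_mxZ.
have e1 : v *m map_mx f A *m vc^T = z *: (v *m vc^T).
  by rewrite vA scalemxAl.
have AsC : (map_mx f A)^T = map_mx f A by apply/matrixP => i j; rewrite !mxE -{1}As mxE.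
have e2 : v *m map_mx f A *m vc^T = (z^* )%C *: (v *m vc^T).
  by rewrite -mulmxA -AsC -trmx_mul vcA linearZ/= scalemxAr.
have vv : (v *m vc^T) 0 0 != 0.
  rewrite mxE psumr_neq0; last by move=> i _; rewrite !mxE mul_conjC_ge0.
  have [i vi] : exists i, v 0 i != 0.
    apply/existsP; apply: contra_neqT v0 => /existsPn v0.
    by apply/rowP => i; rewrite mxE; apply/eqP/negbNE/v0.
  by apply/hasP; exists i; rewrite ?mem_index_enum//= !mxE mul_conjC_gt0.
have zr : z = (z^* )%C.
  have /matrixP/(_ 0 0) := etrans (esym e1) e2.
  by rewrite 2!(mxE scalemx_key); apply: mulIf.
have [x zx] : exists x : R, z = f x.
  case: z zr {zA vA vcA e1 e2} => x y /eqP; rewrite eq_complex /= eqxx/= => /eqP y0.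
  by exists x; apply/eqP; rewrite eq_complex /= eqxx/=; apply/eqP; lra.
exists x; move: zA; rewrite !eigenvalue_root_char -map_char_poly zx.
by rewrite fmorph_root.
Qed.

Lemma symmetric_unit_eigenvector n (A : 'M[R]_n.+1) : A^T = A ->
  exists (a : R) (v : 'rV_n.+1), v *m A = a *: v /\ v *m v^T = 1%:M.
Proof.
move=> /symmetric_eigenvalue[a /eigenvalueP[v vA v0]]; exists a.
have fv : 0 < frob v.
  by rewrite lt_def frob_ge0 andbT; apply: contra_neq v0 => /frob_eq0.
exists ((Num.sqrt (frob v))^-1 *: v).
rewrite -scalemxAl vA !scalerA mulrC; split=> //.
rewrite linearZ /= -scalemxAr -scalemxAl scalerA rV_dotE -invfM -expr2.
by rewrite sqr_sqrtr ?ltW// scale_scalar_mx mulVf ?gt_eqF.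
Qed.

(** Householder reflection along [w = v - e], with the identity when [v = e]. For unit vectors the
    squared norm of [w] is [2 (1 - c)] with [c] the inner product of [v] and [e], so the reflection
    exchanges them. *)
Lemma orthogonal_to_delta n (v : 'rV[R]_n.+1) : v *m v^T = 1%:M ->
  exists H : 'M[R]_n.+1, [/\ H^T = H, H *m H = 1%:M & v *m H = delta_mx 0 0].
Proof.
move=> v1; pose e : 'rV[R]_n.+1 := delta_mx 0 0.
have [w wE] : exists w, w = v - e by exists (v - e).
have e1 : e *m e^T = 1%:M.
  apply/matrixP => i j; rewrite !ord1 !mxE (bigD1 0)//= big1 ?addr0; last first.
    by move=> k /negPf k0; rewrite !mxE !eqxx k0 /= mul0r.
  by rewrite !mxE !eqxx mulr1.
have [w0|w0] := eqVneq w 0.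
  exists 1%:M; rewrite trmx1 !mulmx1; split=> //.
  by apply/eqP; rewrite -subr_eq0 -wE w0.
have fw : frob w != 0 by apply: contra_neq w0 => /frob_eq0.
pose c := (v *m e^T) 0 0.
have ve : v *m e^T = c%:M by exact: mx11_scalar.
have ev : e *m v^T = c%:M by rewrite -[LHS]trmxK trmx_mul trmxK ve tr_scalar_mx.
have vw : v *m w^T = (1 - c)%:M.
  by rewrite wE linearB/= mulmxBr v1 ve -raddfB.
have wwE : (frob w)%:M = (2 * (1 - c))%:M :> 'M[R]_1.
  rewrite -rV_dotE {1}wE mulmxBl vw wE linearB/= mulmxBr e1 ev -!raddfB.
  by congr _%:M; ring.
have fwE : frob w = 2 * (1 - c).
  by move/matrixP: wwE => /(_ 0 0); rewrite !mxE eqxx !mulr1n.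
pose k := 2 / frob w.
exists (1%:M - k *: (w^T *m w)); split.
- by rewrite linearB/= trmx1 linearZ/= trmx_mul trmxK.
- rewrite mulmxBl mul1mx mulmxBr mulmx1 -scalemxAl -scalemxAr.
  rewrite -mulmxA (mulmxA w) rV_dotE mul_scalar_mx.
  rewrite -scalemxAr !scalerA.
  have -> : k * (k * frob w) = k + k by rewrite /k; field.
  by rewrite scalerDl; apply/matrixP => i j; rewrite !mxE; ring.
- rewrite mulmxBr mulmx1 -scalemxAr mulmxA vw mul_scalar_mx scalerA.
  have -> : k * (1 - c) = 1.
    by rewrite /k fwE; field; move: fw; rewrite fwE mulf_eq0 negb_or => /andP[].
  by rewrite scale1r wE opprB addrC subrK.
Qed.

(** Deflation: a Householder reflection carries a unit eigenvector to the first basis vector, so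
    that by symmetry [H A H] is block diagonal with a scalar block and a smaller symmetric one. *)
Theorem real_spectral n (A : 'M[R]_n) : A^T = A ->
  exists (Q : 'M[R]_n) (d : 'rV[R]_n),
    [/\ Q *m Q^T = 1%:M, Q^T *m Q = 1%:M & A = Q^T *m diag_mx d *m Q].
Proof.
elim: n A => [|n IHn] A As.
  by exists 1%:M, 0; split; apply/matrixP => -[].
have [a [v [vA v1]]] := symmetric_unit_eigenvector As.
have [H [Hs HH vH]] := orthogonal_to_delta v1.
have [B B_def] : exists B : 'M[R]_(1 + n), B = H *m A *m H by exists (H *m A *m H).
have Bs : B^T = B by rewrite B_def !trmx_mul Hs As mulmxA.
have eB : delta_mx 0 0 *m B = a *: delta_mx 0 0 :> 'rV_(1 + n).
  by rewrite -vH B_def !mulmxA -(mulmxA v H H) HH mulmx1 vA -scalemxAl.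
have B0 j : B 0 j = a *+ (j == 0).
  by move: eB; rewrite -rowE => /rowP/(_ j); rewrite !mxE eqxx/= mulr_natr.
pose B' := drsubmx B.
have BE : B = block_mx a%:M 0 0 B'.
  rewrite -[LHS](@submxK _ 1 n 1 n); congr block_mx.
  - rewrite [LHS]mx11_scalar; congr _%:M; rewrite !mxE.
    by rewrite [lshift _ _](_ : _ = 0) ?B0//; apply/val_inj.
  - apply/matrixP => i j; rewrite !mxE ord1.
    by rewrite [lshift _ _](_ : _ = 0) ?B0//; apply/val_inj.
  - apply/matrixP => i j; rewrite !mxE ord1 -Bs mxE.
    by rewrite [lshift _ _](_ : _ = 0) ?B0//; apply/val_inj.
have B's : B'^T = B' by rewrite /B' trmx_drsub Bs.
have [Q' [d' [QQ' Q'Q B'E]]] := IHn _ B's.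
pose Q0 : 'M[R]_(1 + n) := block_mx 1%:M 0 0 Q'.
have Q0T : Q0^T = block_mx 1%:M 0 0 Q'^T by rewrite /Q0 tr_block_mx trmx1 !trmx0.
have QQ0 : Q0 *m Q0^T = 1%:M.
  by rewrite Q0T /Q0 mulmx_block !mulmx0 !mul0mx !addr0 !add0r mulmx1 QQ' -scalar_mx_block.
have Q0Q : Q0^T *m Q0 = 1%:M.
  by rewrite Q0T /Q0 mulmx_block !mulmx0 !mul0mx !addr0 !add0r mulmx1 Q'Q -scalar_mx_block.
have BQ : B = Q0^T *m diag_mx (row_mx a%:M d') *m Q0.
  have -> : diag_mx (row_mx a%:M d') = block_mx a%:M 0 0 (diag_mx d').
    rewrite diag_mx_row; congr block_mx.
    by apply/matrixP => i j; rewrite !ord1 !mxE eqxx !mulr1n.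
  rewrite Q0T /Q0 !mulmx_block !mulmx0 !mul0mx !addr0 !add0r.
  by rewrite ?mul0mx ?mulmx0 mul1mx mulmx1 BE B'E.
exists (Q0 *m H), (row_mx a%:M d'); split.
- by rewrite trmx_mul Hs mulmxA -(mulmxA Q0) HH mulmx1.
- by rewrite trmx_mul Hs mulmxA -(mulmxA H) Q0Q mulmx1.
- have -> : A = H *m B *m H by rewrite B_def !mulmxA HH mul1mx -mulmxA HH mulmx1.
  by rewrite {1}BQ trmx_mul Hs !mulmxA.
Qed.

(** Solvability of the normal equations: [x U U^T = 0] forces [x U] to have norm zero, so [U U^T]
    and [U^T] have the same row space, and [v U^T] lies in it. *)
Lemma row_space_projection m N (U : 'M[R]_(m, N)) (v : 'rV[R]_N) :
  exists c : 'rV[R]_m, (v - c *m U) *m U^T = 0.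
Proof.
have kerU : (kermx (U *m U^T) <= kermx U)%MS.
  apply/sub_kermxP; apply/row_matrixP => i; rewrite row_mul row0.
  apply: rV_dot_eq0; rewrite trmx_mul mulmxA -(mulmxA _ U).
  by rewrite -row_mul mulmx_ker row0 mul0mx.
have rk : (\rank U^T <= \rank (U *m U^T))%N.
  rewrite mxrank_tr; have := mxrankS kerU; rewrite !mxrank_ker.
  have := rank_leq_row U; have := rank_leq_row (U *m U^T).
  by move=> h1 h2; rewrite leq_sub2lE.
have sub : (U^T <= U *m U^T)%MS.
  have := mxrank_leqif_sup (submxMl U U^T).
  by move=> /geq_leqif; rewrite rk => /esym.
have /submxP[c cE] : (v *m U^T <= U *m U^T)%MS := submx_trans (submxMl _ _) sub.
by exists c; rewrite mulmxBl -mulmxA -cE subrr.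
Qed.

End LinearAlgebra.

(** * One-dimensional Gaussian integrals *)

Section GaussianIntegrals.
Variable R : realType.
Notation leb := (@lebesgue_measure R).

Import HBNNSimple.

Lemma ge0_integral_density d (T : measurableType d)
  (mu nu : {measure set T -> \bar R}) (g : T -> R) :
  measurable_fun setT g -> (forall x, 0 <= g x) ->
  (forall A, measurable A -> nu A = \int[mu]_(x in A) (g x)%:E)%E ->
  forall f : T -> \bar R, measurable_fun setT f -> (forall x, (0 <= f x)%E) ->
  (\int[nu]_x f x = \int[mu]_x (f x * (g x)%:E))%E.
Proof.
move=> mg g0 nuE f mf f0; pose f_ := nnsfun_approx measurableT mf.
have mgE : measurable_fun setT (EFin \o g) by exact/measurable_EFinP.
have cf x : (f_ ^~ x n)%:E @[n --> \oo] --> f x by apply: cvg_nnsfun_approx.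
have ndf x : {homo (fun n => (f_ n x)%:E) : m n / (m <= n)%N >-> (m <= n)%E}.
  by move=> m n mn; rewrite lee_fin; exact/lefP/nd_nnsfun_approx.
transitivity (limn (fun n => \int[nu]_x (f_ n x)%:E))%E.
  rewrite -monotone_convergence//.
  - by apply: eq_integral => x _; apply/esym/cvg_lim.
  - by move=> n; exact/measurable_EFinP/measurable_funP.
  - by move=> n x _; rewrite lee_fin.
transitivity (limn (fun n => \int[mu]_x ((f_ n x)%:E * (g x)%:E)))%E; last first.
  rewrite -monotone_convergence//.
  - apply: eq_integral => x _; apply/cvg_lim => //.
    by apply: cvgeZr => //; exact: cf.
  - by move=> n; apply: emeasurable_funM => //; exact/measurable_EFinP/measurable_funP.
  - by move=> n x _; rewrite mule_ge0// lee_fin.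
  - by move=> x _ m n mn; rewrite lee_wpmul2r ?lee_fin//; exact: ndf.
congr (limn _); apply/funext => n.
have mI r : measurable (f_ n @^-1` [set r]) by exact: measurable_funPTI.
under eq_integral do rewrite fimfunE -fsumEFin//.
rewrite ge0_integral_fsum//; last 2 first.
- by move=> r; exact/measurable_EFinP/measurable_funM.
- by move=> r x _; rewrite nnfun_muleindic_ge0.
transitivity (\int[mu]_x (\sum_(r \in range (f_ n))
    (r * \1_(f_ n @^-1` [set r]) x)%:E * (g x)%:E))%E; last first.
  apply: eq_integral => x _.
  rewrite [in RHS]fimfunE -fsumEFin// ge0_mule_fsuml// => r.
  by rewrite nnfun_muleindic_ge0.
rewrite ge0_integral_fsum//; last 2 first.
- move=> r; apply: emeasurable_funM => //; exact/measurable_EFinP/measurable_funM.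
- by move=> r x _; apply: mule_ge0; rewrite ?nnfun_muleindic_ge0// lee_fin.
apply: eq_fsbigr => r _.
rewrite integralZl_indic_nnsfun// integral_indic//= setIT nuE//.
have [r0|r0] := ltP r 0.
  by rewrite preimage_nnfun0// integral_set0 mule0 integral0_eq// => x _;
    rewrite indicE in_set0 mulr0 mul0e.
under [RHS]eq_integral do rewrite EFinM -muleA.
rewrite ge0_integralZl//; last 2 first.
- by apply: emeasurable_funM => //; exact/measurable_EFinP.
- by move=> x _; rewrite mule_ge0 ?lee_fin.
congr (_ * _)%E; rewrite integral_mkcond; apply: eq_integral => x _.
by rewrite patchE indicE; case: ifPn => _; rewrite ?mul1e ?mul0e.
Qed.

Lemma normal_prob_ge0_integral (f : R -> \bar R) (m s : R) :
  measurable_fun setT f -> (forall x, (0 <= f x)%E) ->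
  (\int[normal_prob m s]_x f x = \int[leb]_x (f x * (normal_pdf m s x)%:E))%E.
Proof.
move=> mf f0; apply: ge0_integral_density => //.
- exact: measurable_normal_pdf.
- exact: normal_pdf_ge0.
Qed.

(** Completing the square: the integrand is a constant times the density of the normal law with mean
    [b / (1 - a)] and variance [1 / (1 - a)]. *)
Lemma integral_gaussian_tilt (a b : R) : a < 1 ->
  (\int[leb]_x (expR (a * x ^+ 2 / 2 + b * x) * normal_pdf 0 1 x)%:E =
   ((Num.sqrt (1 - a))^-1 * expR (b ^+ 2 / (2 * (1 - a))))%:E)%E.
Proof.
move=> a1; have a0 : 0 < 1 - a by rewrite subr_gt0.
set s := Num.sqrt (1 - a).
have s0 : 0 < s by rewrite sqrtr_gt0.
have s2 : s ^+ 2 = 1 - a by rewrite sqr_sqrtr// ltW.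
clearbody s; set K := s^-1 * _.
have E x : expR (a * x ^+ 2 / 2 + b * x) * normal_pdf 0 1 x =
    K * normal_pdf (b / (1 - a)) s^-1 x.
  rewrite !normal_pdfE ?gt_eqF ?invr_gt0///= /normal_fun /normal_peak.
  have -> : Num.sqrt (s^-1 ^+ 2 * pi *+ 2) = s^-1 * Num.sqrt (1 ^+ 2 * pi *+ 2).
    by rewrite expr1n mul1r -mulrnAr sqrtrM ?sqr_ge0// sqrtr_sqr gtr0_norm ?invr_gt0.
  rewrite invfM invrK /K; set pk := (Num.sqrt (1 ^+ 2 * pi *+ 2))^-1.
  set u := expR (_ + _); set v := expR _; set w := expR _; set z := expR _.
  have -> : s^-1 * w * (s * pk * z) = pk * (w * z).
    by rewrite -!mulrA mulrCA mulKf ?gt_eqF// mulrCA.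
  rewrite mulrCA -!expRD; congr (_ * expR _).
  rewrite exprVn s2 !subr0 expr1n -[(1 - a)^-1 *+ 2]mulr_natr.
  move: a0; clear; move: (1 - a) (subKr 1 a) => c <- c0.
  by field; rewrite ?gt_eqF.
under eq_integral do rewrite E EFinM.
have K0 : 0 <= K by rewrite mulr_ge0 ?expR_ge0// invr_ge0 ltW.
have mpdf : measurable_fun setT (EFin \o normal_pdf (b / (1 - a)) s^-1).
  by apply/measurable_EFinP; exact: measurable_normal_pdf.
rewrite ge0_integralZl// ?integral_normal_pdf ?mule1//.
by move=> x _; rewrite lee_fin normal_pdf_ge0.
Qed.

Lemma integral_normal_exp (a b : R) : a < 1 ->
  (\int[normal_prob 0 1]_x (expR (a * x ^+ 2 / 2 + b * x))%:E =
   ((Num.sqrt (1 - a))^-1 * expR (b ^+ 2 / (2 * (1 - a))))%:E)%E.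
Proof.
move=> a1; rewrite normal_prob_ge0_integral.
- by rewrite -integral_gaussian_tilt.
- apply/measurable_EFinP/measurableT_comp => //.
  by apply: measurable_funD; apply: measurable_funM => //; apply: measurable_funM.
- by move=> x; rewrite lee_fin expR_ge0.
Qed.

Lemma std_normal_pdfE (x : R) :
  normal_pdf 0 1 x = normal_peak 1 * expR (- (x ^+ 2 / 2)).
Proof.
rewrite normal_pdfE ?oner_neq0//= /normal_fun subr0 expr1n; congr (_ * expR _).
by rewrite mulNr.
Qed.

Lemma measurable_std_normal_pdf : measurable_fun setT (normal_pdf 0 1 : R -> R).
Proof. exact: measurable_normal_pdf. Qed.

(** The majorant is the Gaussian tilt with [a = 1 / 2] and [b = 0], whose integral is finite. *)
Lemma integrable_normal_dominated (f : R -> R) (c : R) :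
  measurable_fun setT f -> (forall x, `|f x| <= c * expR (x ^+ 2 / 4)) ->
  leb.-integrable setT (fun x => (f x * normal_pdf 0 1 x)%:E).
Proof.
move=> mf fc; have c0 : 0 <= c.
  have := fc 0; rewrite expr0n/= mul0r expR0 mulr1; exact: le_trans.
pose g x := c * (expR (2^-1 * x ^+ 2 / 2 + 0 * x) * normal_pdf 0 1 x).
have mq : measurable_fun setT (fun x : R => 2^-1 * x ^+ 2 / 2 + 0 * x).
  by apply: measurable_funD; apply: measurable_funM => //; apply: measurable_funM.
have mg0 : measurable_fun setT
    (fun x : R => (expR (2^-1 * x ^+ 2 / 2 + 0 * x) * normal_pdf 0 1 x)%:E).
  apply/measurable_EFinP/measurable_funM; last exact: measurable_std_normal_pdf.
  exact: measurableT_comp.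
have ig : leb.-integrable setT (EFin \o g).
  apply/integrableP; split.
    apply/measurable_EFinP/measurable_funM => //.
    exact/measurable_EFinP.
  under eq_integral => x _.
    rewrite /= /g ger0_norm; last first.
      by rewrite !mulr_ge0 ?expR_ge0 ?normal_pdf_ge0.
    rewrite EFinM; over.
  rewrite ge0_integralZl//; last first.
    by move=> x _; rewrite lee_fin mulr_ge0 ?expR_ge0 ?normal_pdf_ge0.
  rewrite integral_gaussian_tilt ?ltry//.
  by rewrite invf_lt1// ltr1n.
apply: le_integrable ig => //.
  apply/measurable_EFinP/measurable_funM => //; exact: measurable_std_normal_pdf.
move=> x _ /=; have pdf0 := normal_pdf_ge0 0 1 x.
have g0 : 0 <= g x by rewrite /g !mulr_ge0 ?expR_ge0.
rewrite lee_fin (ger0_norm g0) /g.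
rewrite normrM (ger0_norm pdf0) mulrA ler_wpM2r//.
apply: le_trans (fc x) _; rewrite mul0r addr0.
by have -> : 2^-1 * x ^+ 2 / 2 = x ^+ 2 / 4 by field.
Qed.

Lemma normr_le_expR_sqr (x : R) : `|x| <= expR (x ^+ 2 / 4).
Proof.
apply: le_trans (expR_ge1Dx _); rewrite -[x ^+ 2]real_normK ?num_real//.
have := sqr_ge0 (`|x| - 2); nra.
Qed.

Lemma expR_sqr_ge1 (x : R) : 1 <= expR (x ^+ 2 / 4).
Proof. by rewrite -expR0 ler_expR divr_ge0 ?sqr_ge0. Qed.

Lemma is_derive_std_normal_pdf (x : R) :
  is_derive x 1 (normal_pdf 0 1) (- x * normal_pdf 0 1 x).
Proof.
rewrite (_ : normal_pdf 0 1 = fun x => normal_peak 1 * expR (- (x ^+ 2 / 2)));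
  last by apply/funext => y; exact: std_normal_pdfE.
have dq : is_derive x 1 (fun y : R => - (y ^+ 2 / 2)) (- x).
  rewrite (_ : (fun y : R => _) = - ((fun y : R => y ^+ 2) * cst 2^-1))//.
  apply: is_derive_eq; rewrite /= /GRing.scale /=.
  by field.
have de := is_derive1_comp (is_derive_expR _) dq.
have := is_deriveM (is_derive_cst (normal_peak 1) x 1) de.
move=> h; apply: (is_derive_eq h); rewrite /GRing.scale /=.
by ring.
Qed.

Lemma continuous_std_normal_pdf : continuous (normal_pdf 0 1 : R -> R).
Proof. exact: continuous_normal_pdf (oner_neq0 _). Qed.

Lemma is_derive_affine (u v x : R) : is_derive x 1 (fun y : R => u + v * y) v.
Proof.
have h := is_deriveD (is_derive_cst u x 1)
  (is_deriveM (is_derive_cst v x 1) (is_derive_id x 1)).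
by apply: (is_derive_eq h); rewrite /GRing.scale /=; ring.
Qed.

Lemma is_derive_sin_pdf (u v x : R) :
  is_derive x 1 (fun y => sin (u + v * y) * normal_pdf 0 1 y)
    ((v * cos (u + v * x) - x * sin (u + v * x)) * normal_pdf 0 1 x).
Proof.
have h := is_deriveM (is_derive1_comp (is_derive_sin _) (is_derive_affine u v x))
  (is_derive_std_normal_pdf x).
by apply: (is_derive_eq h); rewrite /GRing.scale /=; ring.
Qed.

Lemma measurable_affine (u v : R) : measurable_fun setT (fun y : R => u + v * y).
Proof. by apply: measurable_funD => //; exact: measurable_funM. Qed.

Lemma measurable_sin_affine (u v : R) :
  measurable_fun setT (fun y : R => sin (u + v * y)).
Proof.
apply: (measurableT_comp (f := sin)); last exact: measurable_affine.
exact: continuous_measurable_fun (@continuous_sin R).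
Qed.

Lemma measurable_cos_affine (u v : R) :
  measurable_fun setT (fun y : R => cos (u + v * y)).
Proof.
apply: (measurableT_comp (f := cos)); last exact: measurable_affine.
exact: continuous_measurable_fun (@continuous_cos R).
Qed.

Lemma normr_sin_le1 (x : R) : `|sin x| <= 1.
Proof. by rewrite ler_norml sin_geN1 sin_le1. Qed.

Lemma normr_cos_le1 (x : R) : `|cos x| <= 1.
Proof. by rewrite ler_norml cos_geN1 cos_le1. Qed.

Lemma integrable_cos_pdf (u v : R) :
  leb.-integrable setT (fun x => (cos (u + v * x) * normal_pdf 0 1 x)%:E).
Proof.
apply: (@integrable_normal_dominated _ 1); first exact: measurable_cos_affine.
by move=> x; rewrite mul1r (le_trans (normr_cos_le1 _)) ?expR_sqr_ge1.
Qed.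

Lemma integrable_xsin_pdf (u v : R) :
  leb.-integrable setT (fun x => (x * sin (u + v * x) * normal_pdf 0 1 x)%:E).
Proof.
apply: (@integrable_normal_dominated _ 1).
  by apply: measurable_funM => //; exact: measurable_sin_affine.
move=> x; rewrite mul1r normrM -[leRHS]mulr1.
by rewrite ler_pM ?normr_sin_le1 ?normr_le_expR_sqr.
Qed.

(** Boundary terms of the integration by parts below; [s] is the sign of the endpoint. They decay
    because [exp (x ^ 2 / 2) >= 1 + x ^ 2 / 2 >= x]. *)
Lemma cvg_sin_pdf (u v s : R) : s ^+ 2 = 1 ->
  sin (u + v * (s * n.+1%:R)) * normal_pdf 0 1 (s * n.+1%:R) @[n --> \oo] --> 0.
Proof.
move=> s2; apply: norm_cvg0.
apply: (@squeeze_cvgr _ _ _ _ (cst 0) (fun n => normal_peak 1 * n.+1%:R^-1)).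
- apply: nearW => n; rewrite normr_ge0/= normrM.
  rewrite -[leRHS]mul1r ler_pM ?normr_sin_le1//.
  rewrite ger0_norm ?normal_pdf_ge0// std_normal_pdfE.
  rewrite ler_wpM2l ?normal_peak_ge0// exprMn s2 mul1r expRN lef_pV2 ?posrE ?expR_gt0//.
  apply: le_trans (expR_ge1Dx _).
  have : (0 : R) <= (n.+1%:R - 1) ^+ 2 by exact: sqr_ge0.
  by move: (n.+1%:R) => x; nra.
- exact: cvg_cst.
- rewrite -[X in _ --> X](mulr0 (normal_peak 1)).
  by apply: cvgM; [exact: cvg_cst|exact: cvg_harmonic].
Qed.

(* Gaussian integration by parts, from the fundamental theorem of calculus on [-n, n]. *)
Lemma normal_stein_cos (u v : R) :
  (\int[leb]_x ((v * cos (u + v * x) - x * sin (u + v * x)) * normal_pdf 0 1 x)%:E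
   = 0)%E.
Proof.
pose f x := (v * cos (u + v * x) - x * sin (u + v * x)) * normal_pdf 0 1 x.
rewrite -[LHS]/(\int[leb]_x (f x)%:E)%E.
pose F x := sin (u + v * x) * normal_pdf 0 1 x.
have dF (x : R) : is_derive x (1 : R) F (f x) by exact: is_derive_sin_pdf.
have intf : leb.-integrable setT (EFin \o f).
  have h := integrableB measurableT (integrableZl measurableT v (integrable_cos_pdf u v))
    (integrable_xsin_pdf u v).
  by apply: eq_integrable h => // x _; rewrite /= -EFinM -EFinB /f; congr _%:E; ring.
have mf : measurable_fun setT (EFin \o f) by case/integrableP: intf.
have cpdf := continuous_std_normal_pdf.
have caff (x : R) : {for x, continuous (fun y : R => u + v * y)}.
  apply: differentiable_continuous; apply/derivable1_diffP.
  by have [] := is_derive_affine u v x.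
have cf : continuous f.
  move=> x; apply: cvgM; last exact: cpdf.
  apply: cvgB; apply: cvgM.
  - exact: cvg_cst.
  - by apply: continuous_comp; [exact: caff|exact: continuous_cos].
  - exact: cvg_id.
  - by apply: continuous_comp; [exact: caff|exact: continuous_sin].
have cF (x : R) : {for x, continuous F}.
  apply: differentiable_continuous; apply/derivable1_diffP.
  by have [] := dF x.
(* With [n.+1] the interval is nondegenerate already for [n = 0], as the fundamental theorem
   requires. *)
pose I n : set R := `[(- n.+1%:R), n.+1%:R]%classic.
pose f_ n := (EFin \o f) \_ (I n).
have intfn n : (\int[leb]_x f_ n x = (F n.+1%:R - F (- n.+1%:R))%:E)%E.
  rewrite -integral_mkcond.
  rewrite (continuous_FTC2 (F := F)) ?EFinB//.
  - by rewrite gtrN.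
  - exact: continuous_subspaceT.
  - split=> [x _||]; first by have [] := dF x.
    + by apply: cvg_at_right_filter; exact: cF.
    + by apply: cvg_at_left_filter; exact: cF.
  - by move=> x _; rewrite derive1E; have [_ ->] := dF x.
have lim0 : (\int[leb]_x f_ n x @[n --> \oo] --> 0)%E.
  rewrite (_ : (fun n => _) = EFin \o (fun n => F n.+1%:R - F (- n.+1%:R))); last first.
    by apply/funext => n; rewrite intfn.
  apply: cvg_EFin; first exact: nearW.
  rewrite -[X in _ --> X](subr0 0); apply: cvgB.
  - have := @cvg_sin_pdf u v 1 (expr1n _ _).
    by under eq_fun do rewrite !mul1r.
  - have := @cvg_sin_pdf u v (- 1) (sqrr_sign _ 1).
    by under eq_fun do rewrite !mulN1r.
have mfn n : measurable_fun setT (f_ n).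
  have mI : measurable (I n) by exact: measurable_itv.
  apply: (measurable_restrictT (EFin \o f) mI).1.
  exact: measurable_funS measurableT (@subsetT _ _) mf.
have cvgf : {ae leb, forall x, setT x -> f_ ^~ x @ \oo --> (EFin \o f) x}.
  apply: aeW => x _; apply: cvg_near_cst.
  near=> n; rewrite /f_ patchE ifT// inE /I /= in_itv /= -ler_norml.
  near: n; exists (Num.truncn `|x|) => // n /= xn.
  by rewrite (le_trans (ltW (truncnS_gt _)))// ler_nat.
have bnd : {ae leb, forall x n, setT x -> (`|f_ n x| <= (abse \o (EFin \o f)) x)%E}.
  by apply: aeW => x n _; rewrite /f_ patchE; case: ifP => // _; rewrite abse0 abse_ge0.
have [_ _ lim1] := @dominated_convergence _ _ R leb setT measurableT f_ (EFin \o f)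
  (abse \o (EFin \o f)) mfn mf cvgf (integrable_abse intf) bnd.
by rewrite -(cvg_lim (@ereal_hausdorff R) lim1); exact: cvg_lim lim0.
Unshelve. all: end_near. Qed.

(* The phase-shifted characteristic function satisfies phi' = - v phi. *)
Lemma integral_pdf_cos (u v : R) :
  (\int[leb]_x (cos (u + v * x) * normal_pdf 0 1 x)%:E
   = (cos u * expR (- (v ^+ 2 / 2)))%:E)%E.
Proof.
pose f v x := cos (u + v * x) * normal_pdf 0 1 x.
pose phi v := (\int[leb]_x (f v x))%R.
pose S v := (\int[leb]_x (x * sin (u + v * x) * normal_pdf 0 1 x))%R.
have phiE w : (\int[leb]_x (f w x)%:E = (phi w)%:E)%E.
  by rewrite /phi /Rintegral fineK//; apply: integrable_fin_num => //; exact: integrable_cos_pdf.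
have SE w : S w = w * phi w.
  have := normal_stein_cos u w.
  under eq_integral => x _.
    rewrite (_ : _%:E = (w * f w x)%:E - (x * sin (u + w * x) * normal_pdf 0 1 x)%:E)%E;
      last by rewrite -EFinB; congr _%:E; rewrite /f; ring.
    over.
  rewrite integralB//; last 2 first.
  - have := integrableZl measurableT w (integrable_cos_pdf u w).
    by apply: eq_integrable => // x _; rewrite -EFinM.
  - exact: integrable_xsin_pdf.
  under eq_integral do rewrite EFinM.
  rewrite integralZl//; last exact: integrable_cos_pdf.
  rewrite phiE -[X in (_ - X)%E]fineK; last first.
    by apply: integrable_fin_num => //; exact: integrable_xsin_pdf.
  rewrite -EFinM -EFinB => -[] /eqP; rewrite subr_eq0 => /eqP ->.
  by [].
have df (w x : R) : is_derive w (1 : R) (f ^~ x) (- (x * sin (u + w * x) * normal_pdf 0 1 x)).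
  have h1 : is_derive w (1 : R) (fun y : R => u + y * x) x.
    have h := is_derive_affine u x w.
    rewrite (_ : (fun y : R => _) = (fun y : R => u + x * y))//.
    by apply/funext => y; rewrite mulrC.
  have h := is_deriveM (is_derive1_comp (is_derive_cos _) h1)
    (is_derive_cst (normal_pdf 0 1 x) w 1).
  by apply: (is_derive_eq h); rewrite /GRing.scale /=; ring.
have dphi (w : R) : is_derive w (1 : R) phi (- (w * phi w)).
  have Iw : `]w - 1, w + 1[%classic w by rewrite /= in_itv/= gtrBl ltrDl ltr01.
  have int_f (x : R) : `]w - 1, w + 1[%classic x -> leb.-integrable setT (EFin \o f x).
    by move=> _; exact: integrable_cos_pdf.
  have der_f (x y : R) : `]w - 1, w + 1[%classic x -> setT y -> derivable (f ^~ y) x 1.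
    by move=> _ _; have [] := df x y.
  have partialE (x y : R) : partial1of2 f x y = - (y * sin (u + x * y) * normal_pdf 0 1 y).
    by rewrite partial1of2E; have [_ ->] := df x y.
  (* Since [|sin| <= 1] and [|y| <= exp (y ^ 2 / 4)], this bounds the derivative uniformly in the
     parameter. *)
  pose G (y : R) := expR (y ^+ 2 / 4) * normal_pdf 0 1 y.
  have G0 (y : R) : 0 <= G y by rewrite mulr_ge0 ?expR_ge0 ?normal_pdf_ge0.
  have intG : leb.-integrable setT (EFin \o G).
    apply: (@integrable_normal_dominated _ 1).
      by apply: measurableT_comp => //; apply: measurable_funM.
    by move=> x; rewrite mul1r ger0_norm ?expR_ge0.
  have G_ub (x y : R) : `]w - 1, w + 1[%classic x -> setT y -> `|partial1of2 f x y| <= G y.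
    move=> _ _; rewrite partialE normrN normrM (ger0_norm (normal_pdf_ge0 _ _ _)).
    rewrite ler_wpM2r ?normal_pdf_ge0// normrM -[leRHS]mulr1.
    by rewrite ler_pM ?normr_sin_le1 ?normr_le_expR_sqr.
  apply: DeriveDef.
    exact: (derivable_under_integral measurableT Iw int_f der_f G0 intG G_ub).
  rewrite -derive1E.
  rewrite (differentiation_under_integral measurableT Iw int_f der_f G0 intG G_ub).
  rewrite -SE /S -mulN1r -RintegralZl//; last exact: integrable_xsin_pdf.
  by apply: eq_Rintegral => x _; rewrite partialE mulN1r.
(* The differential equation makes this product constant, equal to its value [cos u] at 0. *)
pose psi (w : R) := phi w * expR (w ^+ 2 / 2).
have dpsi (w : R) : is_derive w (1 : R) psi 0.
  have h1 : is_derive w (1 : R) (fun y : R => y ^+ 2 / 2) w.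
    rewrite (_ : (fun y : R => _) = ((fun y : R => y ^+ 2) * cst 2^-1))//.
    by apply: is_derive_eq; rewrite /= /GRing.scale /=; field.
  have h := is_deriveM (dphi w) (is_derive1_comp (is_derive_expR _) h1).
  by apply: (is_derive_eq h); rewrite /GRing.scale /=; ring.
have phi0 : phi 0 = cos u.
  apply: EFin_inj; rewrite -phiE /f.
  under eq_integral do rewrite mul0r addr0 EFinM.
  rewrite integralZl//; last exact: integrable_normal_pdf.
  by rewrite integral_normal_pdf mule1.
rewrite -/(f v) phiE; congr _%:E.
have := is_derive_0_is_cst v 0 dpsi.
rewrite /psi phi0 expr0n/= mul0r expR0 mulr1 => <-.
by rewrite -mulrA -expRD subrr expR0 mulr1.
Qed.

Lemma integral_normal_cos (u v : R) :
  (\int[normal_prob 0 1]_x (cos (u + v * x))%:E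
   = (cos u * expR (- (v ^+ 2 / 2)))%:E)%E.
Proof.
pose N : probability _ R := normal_prob 0 1.
have N1 : N setT = 1%E by exact: (probability_setT N).
have mc := measurable_cos_affine u v.
have ic : N.-integrable setT (EFin \o (fun x => cos (u + v * x))).
  apply: measurable_bounded_integrable => //.
    by apply: (@le_lt_trans _ _ 1%E); [exact: (probability_le1 N measurableT)|exact: ltry].
  exists 1; split => // M M1 x _ /=; exact: le_trans (normr_cos_le1 _) (ltW M1).
(* The change of density is available for nonnegative integrands, hence [1 + cos] in place of
   [cos]. *)
have h : (\int[N]_x (1 + cos (u + v * x))%:E =
    1 + (cos u * expR (- (v ^+ 2 / 2)))%:E)%E.
  rewrite normal_prob_ge0_integral; last 2 first.
  - by apply/measurable_EFinP; exact: measurable_funD.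
  - by move=> x; rewrite lee_fin -lerBlDl sub0r cos_geN1.
  under eq_integral do rewrite -EFinM mulrDl mul1r EFinD.
  rewrite integralD//; last 2 first.
  - exact: integrable_normal_pdf.
  - exact: integrable_cos_pdf.
  by rewrite integral_normal_pdf integral_pdf_cos.
move: h; under eq_integral do rewrite EFinD.
rewrite integralD//; last first.
  by apply: finite_measure_integrable_cst.
rewrite integral_cst// mul1e -[X in (X + _)%E]/(N setT) N1.
have /fineK <- := integrable_fin_num measurableT ic.
by rewrite -!EFinD => -[] /addrI <-.
Qed.

End GaussianIntegrals.

(** * Independence *)

Section DensityMeasure.
Local Open Scope ereal_scope.
Context d (T : measurableType d) (R : realType) (mu : {measure set T -> \bar R}).
Variables (g : T -> R) (mg : measurable_fun setT g) (g0 : forall x, (0 <= g x)%R).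

(** The proofs about [g] are arguments so that the measure structure can be attached to the term
    itself. *)
Definition density_measure of measurable_fun setT g & (forall x, (0 <= g x)%R) :=
  fun A : set T => \int[mu]_(x in A) (g x)%:E.

Local Notation nu := (density_measure mg g0).

Let nu0 : nu set0 = 0. Proof. exact: integral_set0. Qed.

Let nu_ge0 A : 0 <= nu A.
Proof. by apply: integral_ge0 => x _; rewrite lee_fin. Qed.

Let nu_sigma_additive : semi_sigma_additive nu.
Proof.
move=> F mF tF mUF; rewrite /density_measure ge0_integral_bigcup//.
- by apply: is_cvg_ereal_nneg_natsum_cond => n _ _; exact: nu_ge0.
- by apply/measurable_EFinP; exact: measurable_funS measurableT (@subsetT _ _) mg.
- by move=> x _; rewrite lee_fin.
Qed.

HB.instance Definition _ := isMeasure.Build _ _ _ nu nu0 nu_ge0 nu_sigma_additive.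

End DensityMeasure.

Definition image_measure d d' (T : measurableType d) (U : measurableType d')
  (R : realType) (m : {measure set T -> \bar R}) (f : T -> U)
  (mf : measurable_fun setT f) : {measure set U -> \bar R}.
Proof. by unshelve refine (pushforward m f : {measure set U -> \bar R}). Defined.

Lemma ge0_integral_image_measure d d' (T : measurableType d) (U : measurableType d')
  (R : realType) (m : {measure set T -> \bar R}) (f : T -> U)
  (mf : measurable_fun setT f) (h : U -> \bar R) :
  measurable_fun setT h -> (forall x, (0 <= h x)%E) ->
  (\int[image_measure m mf]_x h x = \int[m]_t h (f t))%E.
Proof. by move=> mh h0; rewrite ge0_integral_pushforward. Qed.

Section Independence.
Context d d' (T : measurableType d) (U : measurableType d') (R : realType).
Variables (P : probability T R) (n : nat) (V : 'I_n -> T -> U) (G : set (set U)).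
Hypotheses (mV : forall i, measurable_fun setT (V i)).
Hypotheses (setIG : setI_closed G) (GT : G setT) (mG : measurable = <<s G >>).
Hypothesis indep : forall B : 'I_n -> set U, (forall i, G (B i)) ->
  P (\bigcap_(i in [set: 'I_n]) (V i @^-1` B i)) = (\prod_(i < n) P (V i @^-1` B i))%E.

Let mGB B : G B -> measurable B.
Proof. by move=> GB; rewrite mG; exact: sub_sigma_algebra. Qed.

Let mcomp (f : U -> R) i : measurable_fun setT f -> measurable_fun setT (f \o V i).
Proof. by move=> mf; exact: measurableT_comp. Qed.

(* The indicators of sets of G are replaced by the functions f i one index at a time. *)
Lemma independent_prod_integral_upto (k : nat) (f : 'I_n -> U -> R) :
  (forall i, measurable_fun setT (f i)) -> (forall i x, 0 <= f i x) ->
  (forall i, (\int[P]_t (f i (V i t))%:E < +oo)%E) ->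
  (forall i : 'I_n, (k <= i)%N -> exists2 B, G B & f i = \1_B) ->
  (\int[P]_t (\prod_i f i (V i t))%:E = \prod_i \int[P]_t (f i (V i t))%:E)%E.
Proof.
elim: k f => [|k IHk] f mf f0 foo fG.
  have /choice[B BP] : forall i, exists B, G B /\ f i = \1_B.
    by move=> i; have [B GB fB] := fG i isT; exists B.
  have fB i t : f i (V i t) = \1_(V i @^-1` B i) t by rewrite (BP i).2.
  have mB i : measurable (V i @^-1` B i).
    by rewrite -[X in measurable X]setTI; apply: mV => //; apply: mGB; exact: (BP i).1.
  under [RHS]eq_bigr => i _ do under eq_integral do rewrite fB.
  under [RHS]eq_bigr => i _ do rewrite integral_indic// setIT.
  rewrite -indep; last by move=> i; exact: (BP i).1.
  rewrite -[X in P X]setIT -integral_indic//; last first.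
    by apply: fin_bigcap_measurable => // i _; exact: mB.
  apply: eq_integral => t _; congr _%:E.
  rewrite indicE; case: (boolP (t \in _)) => [|tB].
    rewrite inE => tB; rewrite big1// => i _; rewrite fB indicE mem_set//.
    exact: tB.
  have [i ti] : exists i, ~ (V i @^-1` B i) t.
    apply/existsNP => tB'; move/negP: tB; apply; rewrite inE => i _; exact: tB'.
  by rewrite (bigD1 i)//= fB indicE memNset// mul0r.
have [kn|nk] := ltnP k n; last first.
  by apply: IHk => // i ki; have := leq_trans nk ki; rewrite leqNgt ltn_ord.
pose i0 := Ordinal kn.
pose g t := \prod_(i | i != i0) f i (V i t).
have g0 t : 0 <= g t by apply: prodr_ge0.
have mg : measurable_fun setT g.
  rewrite (_ : g = fun t => \prod_i (if i != i0 then f i (V i t) else 1)).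
    by apply: measurable_prod => i _; case: (i != i0) => //; exact: mcomp.
  by apply/funext => t; rewrite /g big_mkcond.
pose c : R := \prod_(i | i != i0) fine (\int[P]_t (f i (V i t))%:E).
have I0 i : (0 <= \int[P]_t (f i (V i t))%:E)%E.
  by apply: integral_ge0 => t _; rewrite lee_fin.
have cE : (\prod_(i | i != i0) \int[P]_t (f i (V i t))%:E = c%:E)%E.
  rewrite /c -prodEFin; apply: eq_bigr => i _; rewrite fineK//.
  by rewrite ge0_fin_numE.
have c0 : 0 <= c by apply: prodr_ge0 => i _; exact: fine_ge0.
(* Two finite measures: the law of [V i0] weighted by the product [g] of the other factors, and a
   multiple [c] of the plain law. The induction hypothesis with an indicator at index [i0] says that
   they agree on [G], hence on all measurable sets; integrating [f i0] against both gives the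
   claim. *)
pose nu1 := image_measure (density_measure P mg g0) (mV i0).
pose nu2 := mscale (NngNum c0) (image_measure P (mV i0)).
have agree B : G B -> nu1 B = nu2 B.
  move=> GB; have mVB : measurable (V i0 @^-1` B).
    by rewrite -[X in measurable X]setTI; apply: mV => //; exact: mGB.
  pose f' i := if i == i0 then \1_B : U -> R else f i.
  have f'0 : f' i0 = \1_B by rewrite /f' eqxx.
  have f'N i : i != i0 -> f' i = f i by move=> /negPf ii0; rewrite /f' ii0.
  have gE t : \prod_i f' i (V i t) = \1_B (V i0 t) * g t.
    by rewrite (bigD1 i0)//= f'0; congr (_ * _); apply: eq_bigr => i ii0; rewrite f'N.
  have := IHk f'; rewrite (bigD1 i0)//= f'0.
  under eq_integral => t _ do rewrite gE.
  rewrite (eq_bigr (fun i => \int[P]_t (f i (V i t))%:E)%E); last first.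
    by move=> i ii0; rewrite f'N.
  rewrite cE => h.
  rewrite /nu1 /nu2 /mscale/= /image_measure/= /pushforward /density_measure.
  rewrite integral_mkcond; transitivity (\int[P]_t (\1_B (V i0 t) * g t)%:E)%E.
    apply: eq_integral => t _; rewrite patchE indicE.
    have -> : (t \in V i0 @^-1` B) = (V i0 t \in B) by apply/idP/idP; rewrite !inE.
    by case: (V i0 t \in B); rewrite ?mul1r ?mul0r.
  rewrite h.
  - rewrite muleC; congr (_ * _)%E.
    rewrite (_ : (fun t => _) = (fun t => (\1_(V i0 @^-1` B) t)%:E))//.
    by rewrite integral_indic// setIT.
  - move=> i; rewrite /f'; case: eqP => // _; apply: measurable_indic; exact: mGB.
  - by move=> i x; rewrite /f'; case: eqP => // _; rewrite indicE ler0n.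
  - move=> i; rewrite /f'; case: eqP => // ->.
    rewrite (_ : (fun t => _) = (fun t => (\1_(V i0 @^-1` B) t)%:E))//.
    by rewrite integral_indic// setIT; apply: le_lt_trans (ltry 1); exact: probability_le1.
  - move=> i ki; rewrite /f'; case: eqP => [_|/eqP ii0]; first by exists B.
    by apply: fG; rewrite ltn_neqAle ki andbT; apply: contra_neq ii0 => ki'; exact/val_inj.
have nuE A : measurable A -> nu1 A = nu2 A.
  apply: (measure_unique G (fun=> setT)) => //.
  - by rewrite bigcup_const.
  - move=> _; rewrite agree// /nu2 /mscale/=.
    by rewrite /image_measure/= /pushforward preimage_setT probability_setT mule1 ltry.
have : (\int[nu1]_x (f i0 x)%:E = \int[nu2]_x (f i0 x)%:E)%E.
  by apply: eq_measure_integral => A mA _; exact: nuE.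
have mfE : measurable_fun setT (fun x => (f i0 x)%:E) by exact/measurable_EFinP.
have mfVE : measurable_fun setT (fun t => (f i0 (V i0 t))%:E).
  by apply/measurable_EFinP; exact: mcomp.
rewrite ge0_integral_mscale//; last by move=> x _; rewrite lee_fin.
rewrite !ge0_integral_image_measure//; try by move=> x; rewrite lee_fin.
rewrite (ge0_integral_density (mu := P) (nu := density_measure P mg g0) mg g0
  (fun A _ => erefl))//; last first.
  by move=> x; rewrite lee_fin.
move=> h; rewrite [RHS](bigD1 i0)//= cE muleC -[RHS]h.
by apply: eq_integral => t _; rewrite (bigD1 i0)//= -EFinM.
Qed.

Lemma independent_prod_integral (f : 'I_n -> U -> R) :
  (forall i, measurable_fun setT (f i)) -> (forall i x, 0 <= f i x) ->
  (forall i, (\int[P]_t (f i (V i t))%:E < +oo)%E) ->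
  (\int[P]_t (\prod_i f i (V i t))%:E = \prod_i \int[P]_t (f i (V i t))%:E)%E.
Proof.
move=> mf f0 foo; apply: (@independent_prod_integral_upto n) => // i.
by rewrite leqNgt ltn_ord.
Qed.

End Independence.

(** * Exponential moments of Gaussian quadratic forms *)

Section QuadraticForms.
Context d (T : measurableType d) (R : realType) (P : probability T R).
Variables (p : nat) (Z : 'I_p -> T -> R).
Hypothesis mZ : forall j, measurable_fun setT (Z j).
(* Only the laws of the linear combinations of the coordinates are known. *)
Hypothesis std : forall b : 'I_p -> R, \sum_j b j ^+ 2 = 1 ->
  forall B : set R, measurable B ->
    P [set t | B (\sum_j b j * Z j t)] = normal_prob 0 1 B.

Notation N := (normal_prob (0 : R) 1).
Notation lin b t := (\sum_j b j * Z j t).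

Definition quad (m : 'I_p -> R) (t : T) := \sum_j m j * Z j t ^+ 2.

Lemma measurable_lin b : measurable_fun setT (fun t => lin b t).
Proof. by apply: measurable_sum => j; exact: measurable_funM. Qed.

Lemma measurable_quad m : measurable_fun setT (quad m).
Proof.
by apply: measurable_sum => j; apply: measurable_funM => //; exact: measurable_funX.
Qed.

(** Mean of [exp (sg (b + sqrt m x) ^ 2 / 2)] over a standard normal [x], for [sg = 1] or [sg = -1],
    [m >= 0] and [sg m < 1]. *)
Definition gaussian_factor (sg m b : R) : R :=
  (Num.sqrt (1 - sg * m))^-1 * expR (sg * b ^+ 2 / (2 * (1 - sg * m))).

Lemma gaussian_factor0 sg b : gaussian_factor sg 0 b = expR (sg * b ^+ 2 / 2).
Proof. by rewrite /gaussian_factor mulr0 subr0 sqrtr1 invr1 mul1r mulr1. Qed.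

Lemma integral_normal_expR_sqr (sg m b : R) : sg ^+ 2 = 1 -> 0 <= m -> sg * m < 1 ->
  (\int[N]_x (expR (sg * (b + Num.sqrt m * x) ^+ 2 / 2))%:E
   = (gaussian_factor sg m b)%:E)%E.
Proof.
move=> sg2 m0 sm1.
have s2 : Num.sqrt m ^+ 2 = m by rewrite sqr_sqrtr.
have E x : expR (sg * (b + Num.sqrt m * x) ^+ 2 / 2) =
    expR (sg * b ^+ 2 / 2) * expR (sg * m * x ^+ 2 / 2 + sg * b * Num.sqrt m * x).
  by rewrite -expRD; congr expR; move: (Num.sqrt m) s2 => s <-; field.
under eq_integral do rewrite E EFinM.
have mE : measurable_fun setT
    (fun x : R => (expR (sg * m * x ^+ 2 / 2 + sg * b * Num.sqrt m * x))%:E).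
  apply/measurable_EFinP; apply: measurableT_comp => //.
  by apply: measurable_funD; apply: measurable_funM => //; apply: measurable_funM.
rewrite ge0_integralZl//.
rewrite integral_normal_exp// -EFinM; congr _%:E.
rewrite /gaussian_factor mulrCA -expRD; congr (_ * expR _).
rewrite exprMn s2 exprMn sg2; move: sm1 sg2; set u := sg * m => u1 sg2.
have -> : m = sg * u by rewrite /u mulrA -expr2 sg2 mul1r.
clearbody u; have u0 : 1 - u != 0 by rewrite subr_eq0 eq_sym lt_eqF.
by field.
Qed.

(* Integrating out one auxiliary standard normal variable per coordinate turns the
   quadratic exponent into a linear one. *)
Section Linearization.
Variables (h : R -> R) (sg : R).
Hypothesis sg2 : sg ^+ 2 = 1.
Hypothesis h_normal : forall u v c : R,
  (\int[N]_x (h (u + v * x) * c)%:E = (h u * expR (sg * v ^+ 2 / 2) * c)%:E)%E.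
Hypothesis h_lin : forall b : 'I_p -> R,
  (\int[P]_t (h (lin b t))%:E = (expR (sg * (\sum_j b j ^+ 2) / 2))%:E)%E.
Hypothesis h_fubini : forall (m b : 'I_p -> R) i a, (forall j, 0 <= m j) ->
  (\int[P]_t \int[N]_x (h (lin b t + a * Z i t * x) * expR (sg * quad m t / 2))%:E =
   \int[N]_x \int[P]_t (h (lin b t + a * Z i t * x) * expR (sg * quad m t / 2))%:E)%E.

(** [h] stands for [exp] with [sg = 1] and for [cos] with [sg = -1]. Induction on the number of
    coordinates with a quadratic weight: the term [m Z ^ 2] at [i0] is an average over [x] of the
    linear shift [a Z x] with [a = sqrt m]. After the integrals are exchanged, [i0] has weight 0 and
    coefficient [b + a x], and the integral over [x] of the resulting factor is known. *)
Lemma integral_quad_upto (k : nat) (m b : 'I_p -> R) :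
  (forall j, 0 <= m j) -> (forall j, sg * m j < 1) ->
  (forall j : 'I_p, (k <= j)%N -> m j = 0) ->
  (\int[P]_t (h (lin b t) * expR (sg * quad m t / 2))%:E
   = (\prod_j gaussian_factor sg (m j) (b j))%:E)%E.
Proof.
elim: k m b => [|k IHk] m b m0 sm1 mk.
  have mE j : m j = 0 by exact: mk.
  have q0 t : quad m t = 0 by rewrite /quad big1// => j _; rewrite mE mul0r.
  under eq_integral do rewrite q0 mulr0 mul0r expR0 mulr1.
  rewrite h_lin; congr _%:E.
  under eq_bigr do rewrite mE gaussian_factor0.
  by rewrite -expR_sum -mulr_suml -mulr_sumr.
have [kp|pk] := ltnP k p; last first.
  by apply: IHk => // j kj; have := leq_trans pk kj; rewrite leqNgt ltn_ord.
pose i0 := Ordinal kp; pose a := Num.sqrt (m i0).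
pose m' j := if j == i0 then 0 else m j.
have m'0 j : 0 <= m' j by rewrite /m'; case: eqP.
have qE t : quad m t = quad m' t + m i0 * Z i0 t ^+ 2.
  rewrite /quad (bigD1 i0)//= addrC [in RHS](bigD1 i0)//= /m' eqxx mul0r add0r.
  by congr (_ + _); apply: eq_bigr => j /negPf ->.
have a2 : a ^+ 2 = m i0 by rewrite sqr_sqrtr.
have E t : (h (lin b t) * expR (sg * quad m t / 2))%:E =
    (\int[N]_x (h (lin b t + a * Z i0 t * x) * expR (sg * quad m' t / 2))%:E)%E.
  rewrite h_normal; congr _%:E.
  rewrite -[RHS]mulrA -expRD exprMn a2 qE; congr (_ * expR _); ring.
under eq_integral do rewrite E.
rewrite h_fubini//.
pose b' x j := if j == i0 then b i0 + a * x else b j.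
have lE x t : lin b t + a * Z i0 t * x = lin (b' x) t.
  rewrite (bigD1 i0)//= [in RHS](bigD1 i0)//= /b' eqxx.
  rewrite [in RHS](eq_bigr (fun j => b j * Z j t)); first by ring.
  by move=> j /negPf ->.
under eq_integral => x _.
  under eq_integral do rewrite lE.
  rewrite IHk; [over|by []| |].
  - by move=> j; rewrite /m'; case: eqP => // _; rewrite mulr0.
  - move=> j kj; rewrite /m'; case: eqP => // /eqP ji0; apply: mk.
    by rewrite ltn_neqAle kj andbT; apply: contra_neq ji0 => kj'; exact/val_inj.
rewrite /=.
pose C := \prod_(j | j != i0) gaussian_factor sg (m j) (b j).
have C0 : 0 <= C.
  by apply: prodr_ge0 => j _; rewrite mulr_ge0 ?expR_ge0// invr_ge0 sqrtr_ge0.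
have FE x : \prod_j gaussian_factor sg (m' j) (b' x j) =
    C * expR (sg * (b i0 + a * x) ^+ 2 / 2).
  have mi0 : m' i0 = 0 by rewrite /m' eqxx.
  have bi0 : b' x i0 = b i0 + a * x by rewrite /b' eqxx.
  rewrite (bigD1 i0)//= mulrC mi0 bi0 gaussian_factor0; congr (_ * _).
  by apply: eq_bigr => j /negPf ji0; rewrite /m' /b' ji0.
under eq_integral do rewrite FE EFinM.
have mE : measurable_fun setT
    (fun x : R => (expR (sg * (b i0 + a * x) ^+ 2 / 2))%:E).
  apply/measurable_EFinP; apply: measurableT_comp => //.
  apply: measurable_funM => //; apply: measurable_funM => //.
  by apply: measurable_funX; apply: measurable_funD => //; exact: measurable_funM.
rewrite ge0_integralZl//.
by rewrite integral_normal_expR_sqr// -EFinM [in RHS](bigD1 i0)//= mulrC.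
Qed.
End Linearization.

Lemma integral_std (b : 'I_p -> R) (f : R -> R) : \sum_j b j ^+ 2 = 1 ->
  measurable_fun setT f -> (forall x, 0 <= f x) ->
  (\int[P]_t (f (lin b t))%:E = \int[N]_x (f x)%:E)%E.
Proof.
move=> b1 mf f0.
have mfE : measurable_fun setT (EFin \o f) by exact/measurable_EFinP.
have f0E x : (0 <= (EFin \o f) x)%E by rewrite lee_fin.
have mb : measurable_fun setT (fun t => lin b t : measurableTypeR R).
  exact: measurable_lin.
rewrite -[LHS](ge0_integral_image_measure P mb mfE f0E).
by apply: eq_measure_integral => B mB _; exact: std.
Qed.

(** [std] speaks of unit vectors; the vanishing combination is covered by the alternative
    [s = 0]. *)
Lemma lin_normalize (b : 'I_p -> R) :
  exists (s : R) (b' : 'I_p -> R), [/\ s ^+ 2 = \sum_j b j ^+ 2,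
    forall t, lin b t = s * lin b' t & s = 0 \/ \sum_j b' j ^+ 2 = 1].
Proof.
pose s2 := \sum_j b j ^+ 2; have s20 : 0 <= s2 by apply: sumr_ge0 => j _; exact: sqr_ge0.
have [s0|s0] := eqVneq s2 0.
  have b0 j : b j = 0.
    move/eqP: s0; rewrite psumr_eq0; last by move=> i _; exact: sqr_ge0.
    by move=> /allP/(_ j (mem_index_enum _)); rewrite sqrf_eq0 => /eqP.
  exists 0, b; split; [by rewrite expr0n -/s2 s0| |by left].
  by move=> t; rewrite mul0r big1// => j _; rewrite b0 mul0r.
have s2gt : 0 < s2 by rewrite lt_def s0.
exists (Num.sqrt s2), (fun j => (Num.sqrt s2)^-1 * b j); split.
- by rewrite sqr_sqrtr.
- move=> t; rewrite mulr_sumr; apply: eq_bigr => j _.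
  by rewrite !mulrA mulfV ?mul1r// gt_eqF// sqrtr_gt0.
- right; under eq_bigr do rewrite exprMn.
  by rewrite -mulr_sumr exprVn sqr_sqrtr// mulVf.
Qed.

Lemma integral_expR_lin (b : 'I_p -> R) :
  (\int[P]_t (expR (lin b t))%:E = (expR (1 * (\sum_j b j ^+ 2) / 2))%:E)%E.
Proof.
have [s [b' [s2 lE [s0|b1]]]] := lin_normalize b; under eq_integral do rewrite lE.
  rewrite -s2 s0; under eq_integral do rewrite mul0r expR0.
  by rewrite expr0n mulr0 mul0r expR0 integral_cst// mul1e; exact: probability_setT.
have mf : measurable_fun setT (fun x => expR (s * x)).
  by apply: measurableT_comp => //; exact: measurable_funM.
rewrite (integral_std b1 mf); last by move=> x; exact: expR_ge0.
have := @integral_normal_exp R 0 s ltr01.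
under eq_integral do rewrite mul0r mul0r add0r.
by rewrite subr0 sqrtr1 invr1 mul1r mulr1 -s2 mul1r.
Qed.

Lemma integrable_bounded_prob d' (U : measurableType d') (Q : probability U R)
  (f : U -> R) (M : R) : measurable_fun setT f -> (forall x, `|f x| <= M) ->
  Q.-integrable setT (EFin \o f).
Proof.
move=> mf fM; apply: measurable_bounded_integrable => //.
  by apply: (@le_lt_trans _ _ 1%E); [exact: probability_le1|exact: ltry].
by exists M; split; [exact: num_real|] => K MK x _ /=; exact: le_trans (fM x) (ltW MK).
Qed.

(** Carries an identity known for nonnegative integrands over to the cosine, by adding 1 on both
    sides. *)
Lemma integral_prob_add1 d' (U : measurableType d') (Q : probability U R)
  (f : U -> R) (M : R) : measurable_fun setT f -> (forall x, `|f x| <= M) ->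
  (\int[Q]_x (1 + f x)%:E = 1 + \int[Q]_x (f x)%:E)%E.
Proof.
move=> mf fM; under eq_integral do rewrite EFinD.
rewrite integralD//; last 2 first.
- by apply: finite_measure_integrable_cst.
- exact: integrable_bounded_prob fM.
by congr (_ + _)%E; rewrite integral_cst// mul1e; exact: probability_setT.
Qed.

Lemma integral_cos_lin (b : 'I_p -> R) :
  (\int[P]_t (cos (lin b t))%:E = (expR (-1 * (\sum_j b j ^+ 2) / 2))%:E)%E.
Proof.
have mcos := continuous_measurable_fun (@continuous_cos R).
have [s [b' [s2 lE [s0|b1]]]] := lin_normalize b; under eq_integral do rewrite lE.
  rewrite -s2 s0; under eq_integral do rewrite mul0r cos0.
  by rewrite expr0n mulr0 mul0r expR0 integral_cst// mul1e; exact: probability_setT.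
have mf : measurable_fun setT (fun x => cos (s * x)).
  by apply: (measurableT_comp (f := cos)) => //; exact: measurable_funM.
have mg : measurable_fun setT (fun t => cos (s * lin b' t)).
  by apply: (measurableT_comp (f := fun x => cos (s * x))) => //; exact: measurable_lin.
have m1f : measurable_fun setT (fun x => 1 + cos (s * x)) by exact: measurable_funD.
have h := integral_std b1 m1f.

have pos x : 0 <= 1 + cos (s * x) by rewrite -lerBlDl sub0r cos_geN1.
move: (h pos); rewrite /=.
rewrite (integral_prob_add1 P mg (M := 1)); last by move=> x; exact: normr_cos_le1.
rewrite (integral_prob_add1 N mf (M := 1)); last by move=> x; exact: normr_cos_le1.
have := @integral_normal_cos R 0 s.
under eq_integral do rewrite add0r.
move=> ->; rewrite cos0 mul1r -s2 mulN1r mulNr.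
have /fineK <- := integrable_fin_num measurableT
  (integrable_bounded_prob P mg (M := 1) (fun x => normr_cos_le1 _)).
by rewrite -!EFinD => -[] /addrI ->.
Qed.

Lemma measurable_fubini_integrand (h : R -> R) sg m b i a : measurable_fun setT h ->
  measurable_fun setT (fun z : T * measurableTypeR R =>
    h (lin b z.1 + a * Z i z.1 * z.2) * expR (sg * quad m z.1 / 2)).
Proof.
move=> mh; apply: measurable_funM.
  apply: (measurableT_comp mh); apply: measurable_funD.
    exact: measurableT_comp (measurable_lin b) measurable_fst.
  apply: measurable_funM; last exact: measurable_snd.
  apply: measurable_funM => //.
  exact: measurableT_comp (mZ i) measurable_fst.
apply: measurableT_comp => //; apply: measurable_funM => //; apply: measurable_funM => //.
exact: measurableT_comp (measurable_quad m) measurable_fst.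
Qed.

Lemma integral_expR_quad (m : 'I_p -> R) :
  (forall j, 0 <= m j) -> (forall j, m j < 1) ->
  (\int[P]_t (expR (1 * quad m t / 2))%:E
   = (\prod_j gaussian_factor 1 (m j) 0)%:E)%E.
Proof.
move=> m0 m1.
rewrite -(@integral_quad_upto expR 1 (expr1n _ _) _ integral_expR_lin _ p m (fun=> 0))//.
- apply: eq_integral => t _; rewrite big1 ?expR0 ?mul1r// => j _.
  by rewrite mul0r.
- move=> u v c; have h := @integral_normal_exp R 0 v ltr01.
  under eq_integral => x _.
    rewrite expRD (_ : _ * c = (expR u * c) * expR (0 * x ^+ 2 / 2 + v * x)); last first.
      by rewrite !mul0r add0r mulrAC.
    rewrite EFinM; over.
  rewrite /= integralZl//; last first.
    apply/integrableP; split.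
      apply/measurable_EFinP; apply: measurableT_comp => //.
      by apply: measurable_funD; apply: measurable_funM => //; apply: measurable_funM.
    under eq_integral do rewrite gee0_abs ?lee_fin ?expR_ge0//.
    by rewrite h ltry.
  rewrite h subr0 sqrtr1 invr1 mul1r mulr1 mul1r -EFinM; congr _%:E.
  by rewrite mulrAC.
- move=> m' b i a m'0.
  pose F (z : T * measurableTypeR R) :=
    (expR (lin b z.1 + a * Z i z.1 * z.2) * expR (1 * quad m' z.1 / 2))%:E.
  have mF : measurable_fun setT F.
    by apply/measurable_EFinP; exact: (@measurable_fubini_integrand expR).
  have F0 z : (0 <= F z)%E by rewrite lee_fin mulr_ge0 ?expR_ge0.
  exact: (@fubini_tonelli _ _ _ _ R P N F mF F0).
- by move=> j; rewrite mul1r.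
- by move=> j pj; have := ltn_ord j; rewrite ltnNge pj.
Qed.

(** The cosine integrand is signed; Fubini applies because [|cos| <= 1] and [m j >= 0] keeps the
    exponential factor at most 1. *)
Lemma integral_expR_Nquad (m : 'I_p -> R) :
  (forall j, 0 <= m j) ->
  (\int[P]_t (expR (-1 * quad m t / 2))%:E
   = (\prod_j gaussian_factor (-1) (m j) 0)%:E)%E.
Proof.
move=> m0.
have sg2 : (-1 : R) ^+ 2 = 1 by rewrite sqrrN expr1n.
have mcos := continuous_measurable_fun (@continuous_cos R).
rewrite -(@integral_quad_upto cos (-1) sg2 _ integral_cos_lin _ p m (fun=> 0))//.
- apply: eq_integral => t _; rewrite big1 ?cos0 ?mul1r// => j _.
  by rewrite mul0r.
- move=> u v c; have h := @integral_normal_cos R u v.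
  under eq_integral do rewrite mulrC EFinM.
  rewrite integralZl//; last first.
    apply: (@integrable_bounded_prob _ _ N _ 1); first exact: measurable_cos_affine.
    by move=> x; exact: normr_cos_le1.
  by rewrite h -EFinM mulrC !mulN1r mulNr.
- move=> m' b i a m'0.
  pose F (z : T * measurableTypeR R) :=
    (cos (lin b z.1 + a * Z i z.1 * z.2) * expR (-1 * quad m' z.1 / 2)).
  have mF : measurable_fun setT F by exact: (@measurable_fubini_integrand cos).
  have intF : (P \x N)%E.-integrable setT (EFin \o F).
    apply: (@integrable_bounded_prob _ _ _ _ 1) => // z.
    rewrite normrM -[leRHS]mul1r ler_pM ?normr_cos_le1//.
    rewrite ger0_norm ?expR_ge0// -[leRHS]expR0 ler_expR.
    rewrite mulN1r mulNr oppr_le0 divr_ge0// sumr_ge0// => j _.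
    by rewrite mulr_ge0// sqr_ge0.
  exact: (@Fubini _ _ _ _ R P N _ intF).
- by move=> j; rewrite mulN1r; apply: le_lt_trans ltr01; rewrite oppr_le0.
- by move=> j pj; have := ltn_ord j; rewrite ltnNge pj.
Qed.

End QuadraticForms.

(** * Tail bounds *)

Section TailBounds.
Variable R : realType.

(** The left side is the mean of [exp (sg m (Z ^ 2 - 1) / 2)] for a standard normal [Z]. After
    squaring, the claim becomes [1 <= (1 - sg m) exp (sg m + m ^ 2)]. *)
Lemma gaussian_factor_le (sg m : R) : sg = 1 \/ sg = -1 -> 0 <= m <= 4^-1 ->
  gaussian_factor sg m 0 * expR (- (sg * m / 2)) <= expR (m ^+ 2 / 2).
Proof.
move=> sgE /andP[m0 m4].
have sq (w : R) : expR w ^+ 2 = expR (w + w) by rewrite [LHS]expr2 expRD.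
have v1 : 0 < 1 - sg * m by case: sgE => ->; lra.
have key : 1 <= (1 - sg * m) * expR (sg * m + m ^+ 2).
  case: sgE => ->.
  (* Here [exp v >= 1 + v] would give only [(1 - m) (1 + m + m ^ 2) = 1 - m ^ 3], which is too
     small; applying it to half the exponent and squaring recovers the loss. *)
  - rewrite !mul1r; have -> : expR (m + m ^+ 2) = expR ((m + m ^+ 2) / 2) ^+ 2.
      by rewrite sq; congr expR; field.
    have e1 := expR_ge1Dx ((m + m ^+ 2) / 2).
    have w0 : 0 <= 1 + (m + m ^+ 2) / 2 by nra.
    have e2 : (1 + (m + m ^+ 2) / 2) ^+ 2 <= expR ((m + m ^+ 2) / 2) ^+ 2.
      by rewrite ler_sqr ?nnegrE// expR_ge0.
    have k1 : 1 <= (1 - m) * (1 + (m + m ^+ 2) / 2) ^+ 2.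
      have -> : (1 - m) * (1 + (m + m ^+ 2) / 2) ^+ 2 =
        1 + m ^+ 2 / 4 * (1 - 3 * m - m ^+ 2 - m ^+ 3) by field.
      rewrite lerDl mulr_ge0 ?divr_ge0 ?sqr_ge0//.
      have m2 : m ^+ 2 <= 4^-1 ^+ 2 by rewrite ler_sqr ?nnegrE//; lra.
      have m3 : m ^+ 3 <= 4^-1 ^+ 3 by rewrite lerXn2r ?nnegrE//; lra.
      lra.
    by apply: (le_trans k1); rewrite ler_wpM2l//; lra.
  - rewrite !mulN1r opprK; have e1 := expR_ge1Dx (- m + m ^+ 2).
    apply: (@le_trans _ _ ((1 + m) * (1 + (- m + m ^+ 2)))).
      have -> : (1 + m) * (1 + (- m + m ^+ 2)) = 1 + m ^+ 3 by ring.
      by rewrite lerDl exprn_ge0.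
    by rewrite ler_wpM2l//; lra.
rewrite /gaussian_factor expr0n mulr0 mul0r expR0 mulr1.
set s := Num.sqrt _; have s0 : 0 < s by rewrite sqrtr_gt0.
have s2 : s ^+ 2 = 1 - sg * m by rewrite sqr_sqrtr// ltW.
rewrite mulrC ler_pdivrMr// -(@ler_sqr _ (expR _)) ?nnegrE ?expR_ge0//; last first.
  by rewrite mulr_ge0 ?expR_ge0// ltW.
rewrite exprMn s2 !sq -(ler_pM2r (expR_gt0 (sg * m))) -expRD [leRHS]mulrAC -expRD.
have -> : - (sg * m / 2) + - (sg * m / 2) + sg * m = 0 by field.
have -> : m ^+ 2 / 2 + m ^+ 2 / 2 + sg * m = sg * m + m ^+ 2 by field.
by rewrite expR0 mulrC.
Qed.

End TailBounds.

(** * Boxes as a generating class, closed under intersection, for the measurable sets of tuples *)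

Section BoxSystem.
Context (R : realType) (p : nat).

Definition box (B : 'I_p -> set R) : set (p.-tuple R) :=
  [set v | forall k, B k (tnth v k)].

Definition boxes : set (set (p.-tuple R)) :=
  [set box B | B in [set B : 'I_p -> set R | forall k, measurable (B k)]].

Lemma measurable_box B : (forall k, measurable (B k)) -> measurable (box B).
Proof.
move=> mB; rewrite (_ : box B = \bigcap_(k in [set: 'I_p]) ((fun v => tnth v k) @^-1` B k)).
  apply: fin_bigcap_measurable => // k _.
  rewrite -[X in measurable X]setTI.
  exact: (measurable_tnth k).
by apply/seteqP; split=> [v vB k _|v vB k]; [exact: vB|exact: (vB k I)].
Qed.

Lemma setI_closed_boxes : setI_closed boxes.
Proof.
move=> _ _ [B mB <-] [C mC <-]; exists (fun k => B k `&` C k).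
  by move=> k; exact: measurableI.
by apply/seteqP; split=> [v h|v [h1 h2] k]; [split=> k; have [] := h k|split].
Qed.

Lemma boxesT : boxes setT.
Proof. by exists (fun=> setT) => //; apply/seteqP; split. Qed.

Lemma measurable_tupleE : measurable = <<s boxes >>.
Proof.
apply/seteqP; split.
- apply: smallest_sub; first exact: smallest_sigma_algebra.
  rewrite -bigcup_seq => A /= [i _ [B mB <-]]; apply: sub_sigma_algebra.
  exists (fun k => if k == i then B else setT).
    by move=> k /=; case: eqP.
  rewrite setTI; apply/seteqP; split=> [v /(_ i)|v vB k]; first by rewrite eqxx.
  by case: eqP => // ->.
- apply: smallest_sub; first exact: sigma_algebra_measurable.
  by move=> _ [B mB <-]; exact: measurable_box.
Qed.

End BoxSystem.

(** * Tail bounds for quadratic forms summed over the sample *)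

Section SampleTail.
Context d (T : measurableType d) (R : realType) (P : probability T R) (n p : nat).
Variables (X : 'I_n -> 'I_p -> T -> R) (A : 'M[R]_p).
Hypothesis mX : forall i k, measurable_fun setT (X i k).
Hypothesis indep : forall B : 'I_n -> 'I_p -> set R, (forall i k, measurable (B i k)) ->
  P (\bigcap_(i in [set: 'I_n]) [set t | forall k, B i k (X i k t)])
  = (\prod_(i < n) P [set t | forall k, B i k (X i k t)])%E.

Definition whitened i j t := \sum_k A k j * X i k t.

Hypothesis std : forall i (b : 'I_p -> R), \sum_j b j ^+ 2 = 1 ->
  forall B : set R, measurable B ->
    P [set t | B (\sum_j b j * whitened i j t)] = normal_prob 0 1 B.

Lemma measurable_whitened i j : measurable_fun setT (whitened i j).
Proof. by apply: measurable_sum => k; exact: measurable_funM. Qed.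

Let V i t : p.-tuple R := [tuple X i k t | k < p].

Let mV i : measurable_fun setT (V i).
Proof.
apply/measurable_fun_tnthP => k /=.
by rewrite (_ : _ \o _ = X i k)//; apply/funext => t /=; rewrite tnth_mktuple.
Qed.

Let indepV (B : 'I_n -> set (p.-tuple R)) : (forall i, boxes (B i)) ->
  P (\bigcap_(i in [set: 'I_n]) (V i @^-1` B i)) = (\prod_(i < n) P (V i @^-1` B i))%E.
Proof.
move=> bB; have /choice[C CP] : forall i, exists C : 'I_p -> set R,
    (forall k, measurable (C k)) /\ box C = B i.
  by move=> i; have [C mC CB] := bB i; exists C.
have BE i : V i @^-1` B i = [set t | forall k, C i k (X i k t)].
  have [_ <-] := CP i; apply/seteqP.
  by split=> t /= h k; have := h k; rewrite tnth_mktuple.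
under eq_bigcapr do rewrite BE.
under [RHS]eq_bigr do rewrite BE.
by apply: indep => i k; have [] := CP i.
Qed.

Lemma integral_prod_expR_quad (sg : R) (u : 'I_p -> R) (c : R) :
  (forall i, \int[P]_t (expR (sg * quad (whitened i) u t / 2))%:E = c%:E)%E ->
  (\int[P]_t (expR (\sum_i sg * quad (whitened i) u t / 2))%:E = (c ^+ n)%:E)%E.
Proof.
move=> hc.
pose f (v : p.-tuple R) :=
  expR (sg * (\sum_j u j * (\sum_k A k j * tnth v k) ^+ 2) / 2).
have fE i t : expR (sg * quad (whitened i) u t / 2) = f (V i t).
  rewrite /f (_ : quad (whitened i) u t =
    \sum_j u j * (\sum_k A k j * tnth (V i t) k) ^+ 2)//.
  apply: eq_bigr => j _; congr (_ * _ ^+ 2); apply: eq_bigr => k _.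
  by rewrite tnth_mktuple.
have mf : measurable_fun setT f.
  apply: measurableT_comp => //; apply: measurable_funM => //; apply: measurable_funM => //.
  apply: measurable_sum => j; apply: measurable_funM => //; apply: measurable_funX.
  by apply: measurable_sum => k; apply: measurable_funM => //; exact: measurable_tnth.
under eq_integral => t _ do rewrite expR_sum (eq_bigr _ (fun i _ => fE i t)).
rewrite (independent_prod_integral mV (@setI_closed_boxes R p) (@boxesT R p)
  (@measurable_tupleE R p) indepV (f := fun=> f))//.
- under eq_bigr => i _ do (under eq_integral do rewrite -fE; rewrite hc).
  by rewrite prodEFin prodr_const card_ord.
- by move=> i x; exact: expR_ge0.
- by move=> i; under eq_integral do rewrite -fE; rewrite hc ltry.
Qed.

(** Markov's inequality for the exponential of the sum over the sample; [sg = -1] gives the lower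
    tail of the same nonnegative form. *)
Lemma nneg_form_tail (sg F y : R) (m : 'I_p -> R) :
  sg = 1 \/ sg = -1 -> (forall j, 0 <= m j) -> \sum_j m j ^+ 2 <= F -> 0 < F ->
  0 <= y <= Num.sqrt F / 2 ->
  (P [set t | (n%:R * y <= sg * \sum_i (quad (whitened i) m t - \sum_j m j))%R]
   <= (expR (- (n%:R * y ^+ 2 / (8 * F))))%:E)%E.
Proof.
move=> sgE m0 mF F0 /andP[y0 yF].
have F2 : Num.sqrt F ^+ 2 = F by rewrite sqr_sqrtr// ltW.
have sF0 : 0 < Num.sqrt F by rewrite sqrtr_gt0.
have mjF j : m j <= Num.sqrt F.
  rewrite -(ger0_norm (m0 j)) -sqrtr_sqr ler_wsqrtr//; apply: le_trans mF.
  by rewrite (bigD1 j)//= lerDl sumr_ge0// => k _; exact: sqr_ge0.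
(* The Chernoff parameter: it minimises [2 F s ^ 2 - s y], with minimum [- y ^ 2 / (8 F)]. The bound
   on [y] keeps the weights [u j] in the range of [gaussian_factor_le]. *)
pose s := y / (4 * F); have s0 : 0 <= s by rewrite divr_ge0// mulr_ge0// ltW.
pose u j := 2 * s * m j.
have u0 j : 0 <= u j by rewrite mulr_ge0// mulr_ge0.
have u4 j : u j <= 4^-1.
  have -> : u j = y * m j / (2 * F) by rewrite /u /s; field; rewrite gt_eqF.
  rewrite ler_pdivrMr ?mulr_gt0//.
  apply: (@le_trans _ _ (Num.sqrt F / 2 * Num.sqrt F)); first by rewrite ler_pM.
  by rewrite -{3}F2 expr2 le_eqVlt; apply/orP; left; apply/eqP; field.
pose c := \prod_j gaussian_factor sg (u j) 0.
have hc i : (\int[P]_t (expR (sg * quad (whitened i) u t / 2))%:E = c%:E)%E.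
  rewrite /c; case: sgE => ->.
  - apply: integral_expR_quad => //; [exact: measurable_whitened|exact: std|].
    by move=> j; apply: le_lt_trans (u4 j) _; rewrite invf_lt1// ltr1n.
  - by apply: integral_expR_Nquad => //; [exact: measurable_whitened|exact: std].
have hI := integral_prod_expR_quad hc.
set E := [set t | _].
have mquad i w := measurable_quad (measurable_whitened i) w.
have mW : measurable_fun setT
    (fun t => sg * \sum_i (quad (whitened i) m t - \sum_j m j)).
  by apply: measurable_funM => //; apply: measurable_sum => i; exact: measurable_funB.
have mE : measurable E.
  rewrite (_ : E = (fun t => sg * \sum_i (quad (whitened i) m t - \sum_j m j)) @^-1`
    `[n%:R * y, +oo[%classic).
    by rewrite -[X in measurable X]setTI; exact: mW.
  by apply/seteqP; split=> t /=; rewrite in_itv/= andbT.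
pose K := expR (- (s * sg * (n%:R * \sum_j m j) + s * (n%:R * y))).
have K0 : 0 <= K by exact: expR_ge0.
have quadE i t : sg * quad (whitened i) u t / 2 = s * sg * quad (whitened i) m t.
  rewrite /quad !mulr_sumr mulr_suml; apply: eq_bigr => j _; rewrite /u.
  by field.
have mexp : measurable_fun setT
    (fun t => (expR (\sum_i sg * quad (whitened i) u t / 2))%:E).
  apply/measurable_EFinP; apply: measurableT_comp => //; apply: measurable_sum => i.
  by apply: measurable_funM => //; exact: measurable_funM.
apply: (@le_trans _ _ (K * c ^+ n)%:E).
  rewrite EFinM -hI -ge0_integralZl//.
  rewrite -[X in P X]setIT -integral_indic//.
  apply: ge0_le_integral => //.
  - by apply/measurable_EFinP; exact: measurable_indic.
  - exact: measurable_funeM.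
  - move=> t _; rewrite -EFinM lee_fin indicE; case: (boolP (t \in E)) => [|_]; last first.
      by rewrite mulr_ge0// expR_ge0.
    rewrite inE /E /= => tE; rewrite /K -expRD -[leLHS]expR0 ler_expR.
    under eq_bigr do rewrite quadE.
    rewrite -mulr_sumr; move: tE; rewrite big_split/= sumr_const card_ord mulNrn -mulr_natl.
    set S := \sum_i quad _ _ _; set M := \sum_j m j => tE.
    have := ler_wpM2l s0 tE; lra.
rewrite lee_fin /K.
have cle : c * expR (- (s * sg * \sum_j m j)) <= expR (y ^+ 2 / (8 * F)).
  rewrite mulr_sumr -sumrN expR_sum -big_split/=.
  apply: (@le_trans _ _ (\prod_j expR (u j ^+ 2 / 2))).
    apply: ler_prod => j _; apply/andP; split.
      by rewrite mulr_ge0 ?expR_ge0// mulr_ge0 ?expR_ge0// invr_ge0 sqrtr_ge0.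
    have -> : s * sg * m j = sg * u j / 2 by rewrite /u; field.
    by apply: gaussian_factor_le; rewrite ?u0 ?u4.
  rewrite -expR_sum ler_expR -mulr_suml.
  under eq_bigr do rewrite exprMn.
  rewrite -mulr_sumr; apply: (@le_trans _ _ ((2 * s) ^+ 2 * F / 2)).
    by rewrite ler_wpM2r// ler_wpM2l ?sqr_ge0.
  by rewrite le_eqVlt; apply/orP; left; apply/eqP; rewrite /s; field; rewrite gt_eqF.
have c0 : 0 <= c.
  by apply: prodr_ge0 => j _; rewrite mulr_ge0 ?expR_ge0// invr_ge0 sqrtr_ge0.
have -> : expR (- (s * sg * (n%:R * \sum_j m j) + s * (n%:R * y))) * c ^+ n =
    (c * expR (- (s * sg * \sum_j m j))) ^+ n * expR (- (s * (n%:R * y))).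
  rewrite exprMn -expRM_natl -[RHS]mulrA -expRD [RHS]mulrC; congr (expR _ * _).
  by ring.
apply: (@le_trans _ _ (expR (y ^+ 2 / (8 * F)) ^+ n * expR (- (s * (n%:R * y))))).
  by rewrite ler_wpM2r ?expR_ge0// lerXn2r ?nnegrE ?expR_ge0 ?mulr_ge0 ?expR_ge0.
rewrite -expRM_natl -expRD ler_expR le_eqVlt; apply/orP; left; apply/eqP.
by rewrite /s; field; rewrite gt_eqF.
Qed.

Definition form_deviation (m : 'I_p -> R) t :=
  \sum_i (quad (whitened i) m t - \sum_j m j).

Lemma measurable_form_deviation m : measurable_fun setT (form_deviation m).
Proof.
apply: measurable_sum => i; apply: measurable_funB => //.
exact: measurable_quad (measurable_whitened i) m.
Qed.

(** The positive and negative parts of [m] each get half of the threshold. With [y = tau sqrt F / 2]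
    the exponent [y ^ 2 / (8 F)] is [tau ^ 2 / 32], and [tau <= 1] is the range condition on [y]. *)
Lemma form_tail (tau F : R) (m : 'I_p -> R) :
  \sum_j m j ^+ 2 = F -> 0 < F -> 0 <= tau <= 1 ->
  (P [set t | (n%:R * (tau * Num.sqrt F) <= form_deviation m t)%R]
   <= (2 * expR (- (n%:R * tau ^+ 2 / 32)))%:E)%E.
Proof.
move=> mF F0 /andP[tau0 tau1].
have F2 : Num.sqrt F ^+ 2 = F by rewrite sqr_sqrtr// ltW.
have sF0 : 0 < Num.sqrt F by rewrite sqrtr_gt0.
pose mp j := Num.max (m j) 0; pose mn j := Num.max (- m j) 0.
have mp0 j : 0 <= mp j by rewrite le_max lexx orbT.
have mn0 j : 0 <= mn j by rewrite le_max lexx orbT.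
have mE j : m j = mp j - mn j.
  by rewrite /mp /mn; case: (leP (m j) 0) => h; case: (leP (- m j) 0) => h'; lra.
have mple j : mp j ^+ 2 <= m j ^+ 2.
  by rewrite /mp; case: (leP (m j) 0) => h; rewrite ?expr0n ?sqr_ge0.
have mnle j : mn j ^+ 2 <= m j ^+ 2.
  by rewrite /mn; case: (leP (- m j) 0) => h; rewrite ?expr0n ?sqr_ge0 ?sqrrN.
have mpF : \sum_j mp j ^+ 2 <= F by rewrite -mF ler_sum.
have mnF : \sum_j mn j ^+ 2 <= F by rewrite -mF ler_sum.
pose y := tau * Num.sqrt F / 2.
have yb : 0 <= y <= Num.sqrt F / 2.
  have sF := ltW sF0.
  by rewrite divr_ge0 ?mulr_ge0//= ler_wpM2r// -[leRHS]mul1r ler_wpM2r.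
have tailp := @nneg_form_tail 1 F y mp (or_introl erefl) mp0 _ F0 yb.
have tailn := @nneg_form_tail (-1) F y mn (or_intror erefl) mn0 _ F0 yb.
have {}tailp := tailp mpF; have {}tailn := tailn mnF.
set Ep := [set t | _] in tailp; set En := [set t | _] in tailn.
have devE t : form_deviation m t = form_deviation mp t - form_deviation mn t.
  rewrite /form_deviation -sumrB; apply: eq_bigr => i _; rewrite /quad.
  set z := whitened i.
  have -> : \sum_j m j * z j t ^+ 2 = \sum_j mp j * z j t ^+ 2 - \sum_j mn j * z j t ^+ 2.
    by rewrite -sumrB; apply: eq_bigr => j _; rewrite mE mulrBl.
  have -> : \sum_j m j = \sum_j mp j - \sum_j mn j.
    by rewrite -sumrB; apply: eq_bigr => j _; rewrite mE.
  by ring.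
have mdev := measurable_form_deviation.
have mge (c : R) (f : T -> R) : measurable_fun setT f -> measurable [set t | c <= f t].
  move=> mf; rewrite (_ : [set t | _] = f @^-1` `[c, +oo[%classic).
    by rewrite -[X in measurable X]setTI; exact: mf.
  by apply/seteqP; split=> t /=; rewrite in_itv/= andbT.
have mEp : measurable Ep by apply: mge; apply: measurable_funM => //; exact: mdev.
have mEn : measurable En by apply: mge; apply: measurable_funM => //; exact: mdev.
apply: (@le_trans _ _ (P (Ep `|` En))).
  apply: le_measure; rewrite ?inE.
  - exact: mge.
  - exact: measurableU.
  - move=> t /= tE; case: (leP (n%:R * y) (1 * form_deviation mp t)) => h1; first by left.
    right; rewrite /En /= -/(form_deviation mn t); move: tE h1; rewrite devE /y.
    by move: (form_deviation mp t) (form_deviation mn t) => a b; lra.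
apply: (le_trans (measureU2 P mEp mEn)).
have -> : 2 * expR (- (n%:R * tau ^+ 2 / 32)) =
  expR (- (n%:R * y ^+ 2 / (8 * F))) + expR (- (n%:R * y ^+ 2 / (8 * F))).
  rewrite mulr_natl mulr2n; suff -> : n%:R * y ^+ 2 / (8 * F) = n%:R * tau ^+ 2 / 32 by [].
  by rewrite /y; move: (Num.sqrt F) F2 sF0 => r <- r0; field; rewrite gt_eqF.
by rewrite EFinD leeD.
Qed.

End SampleTail.

(** * Likelihood deficit and noise *)

Section GaussianDivergence.
Variable R : realType.

Lemma ln_le_tangent (c x : R) : 0 < c -> 0 < x -> ln x <= ln c + (x - c) / c.
Proof.
move=> c0 x0; have -> : x = c * (x / c) by rewrite mulrCA divff ?mulr1// gt_eqF.
rewrite lnM ?posrE ?divr_gt0// lerD2l.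
have h : -1 < x / c - 1 by rewrite ltrBrDl subrr divr_gt0.
have := le_ln1Dx h; rewrite addrC subrK => /le_trans; apply.
by rewrite le_eqVlt; apply/orP; left; apply/eqP; field; rewrite gt_eqF.
Qed.

(** Concavity: the tangent of [ln] at [1 + t d] is evaluated at [1 + d] with weight [t] and at 1
    with weight [1 - t]; the linear terms cancel. *)
Lemma ln_scale_le (t d : R) : 0 <= t <= 1 -> 0 < 1 + d -> t * ln (1 + d) <= ln (1 + t * d).
Proof.
move=> /andP[t0 t1] d1; have c0 : 0 < 1 + t * d.
  have [->|tn] := eqVneq t 1; first by rewrite mul1r.
  have t1' : 0 < 1 - t by rewrite subr_gt0 lt_neqAle tn.
  have -> : 1 + t * d = (1 - t) + t * (1 + d) by ring.
  by rewrite ltr_pwDl// mulr_ge0// ltW.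
have h1 := ler_wpM2l t0 (ln_le_tangent c0 d1).
have t1' : 0 <= 1 - t by rewrite subr_ge0.
have h2 := ler_wpM2l t1' (ln_le_tangent c0 ltr01); rewrite ln1 mulr0 in h2.
have e : t * ((1 + d - (1 + t * d)) / (1 + t * d)) +
    (1 - t) * ((1 - (1 + t * d)) / (1 + t * d)) = 0.
  by field; rewrite gt_eqF.
move: h1 h2 e; rewrite !mulrDr; move: (ln (1 + t * d)) (ln (1 + d)) => u v.
set a := t * (_ / _); set b := (1 - t) * (_ / _) => h1 h2 e; lra.
Qed.

Lemma sub_ln_ge_sqr (x : R) : `|x| <= 3 / 4 -> x ^+ 2 / 4 <= x - ln (1 + x).
Proof.
rewrite ler_norml => /andP[x1 x2]; have x0 : 0 < 1 + x by lra.
rewrite lerBrDr -lerBrDl; set w := x - x ^+ 2 / 4.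
rewrite -ler_expR lnK ?posrE//.
(* The goal is [1 + x <= exp (x - x ^ 2 / 4)]. The square [(1 + w / 2) ^ 2] falls below [1 + x] for
   small positive [x]; the fourth power of [1 + w / 4] is sharp enough on the whole range. *)
pose u := w / 4; have -> : expR w = expR u ^+ 4.
  by rewrite -expRM_natl; congr expR; rewrite /u; field.
have u0 : 0 <= 1 + u by rewrite /u /w; nra.
apply: (@le_trans _ _ ((1 + u) ^+ 4)); last first.
  by rewrite lerXn2r ?nnegrE ?expR_ge0// expR_ge1Dx.
have -> : (1 + u) ^+ 4 =
    1 + x + (x ^+ 2 / 16 * ((1 - x / 4) ^+ 2 * (6 + 4 * u) - 4) + u ^+ 4).
  by rewrite /u /w; field.
rewrite lerDl addr_ge0// ?exprn_even_ge0// mulr_ge0//.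
  by rewrite divr_ge0 ?sqr_ge0.
have h1 : 1 - x / 2 <= (1 - x / 4) ^+ 2 by have := sqr_ge0 (x / 4); nra.
have h2 : 0 <= 6 + 4 * u by rewrite /u /w; nra.
have h3 : 4 <= (1 - x / 2) * (6 + 4 * u).
  have -> : (1 - x / 2) * (6 + 4 * u) = 6 - 2 * x - 3 / 4 * x ^+ 2 + x ^+ 2 * x / 8.
    by rewrite /u /w; field.
  have s : x ^+ 2 <= 9 / 16 by nra.
  have := sqr_ge0 x; nra.
by rewrite subr_ge0; apply: le_trans h3 _; rewrite ler_wpM2r.
Qed.

Lemma divergence_scale_ge (t d : R) : 0 <= t <= 1 -> 0 < 1 + d -> `|t * d| <= 3 / 4 ->
  (t * d) ^+ 2 / 4 <= t * (d - ln (1 + d)).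
Proof.
move=> t01 d1 td; apply: le_trans (sub_ln_ge_sqr td) _.
by rewrite mulrBr lerD2l lerN2 ln_scale_le.
Qed.

End GaussianDivergence.

(** * Whitening, spectra, and the likelihood deficit along a ray *)

Section Whitening.
Variables (R : realType) (p : nat).

Lemma frob_tr m n (A : 'M[R]_(m, n)) : frob A^T = frob A.
Proof.
rewrite /frob exchange_big; apply: eq_bigr => i _; apply: eq_bigr => j _.
by rewrite mxE.
Qed.

Lemma frob_spectral (Q : 'M[R]_p) (d : 'rV[R]_p) : Q *m Q^T = 1%:M ->
  frob (Q^T *m diag_mx d *m Q) = \sum_i d 0 i ^+ 2.
Proof.
move=> QQ; rewrite frobE !trmx_mul trmxK tr_diag_mx !mulmxA.
rewrite -(mulmxA _ Q Q^T) QQ mulmx1 -!mulmxA mxtrace_mulC -!mulmxA QQ mulmx1.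
rewrite mulmx_diag mxtrace_diag; apply: eq_bigr => i _.
by rewrite mxE expr2.
Qed.

Lemma posdef_spectral (A Q : 'M[R]_p) (d : 'rV[R]_p) : posdef A ->
  Q *m Q^T = 1%:M -> A = Q^T *m diag_mx d *m Q -> forall i, 0 < d 0 i.
Proof.
move=> [_ Apos] QQ AE i.
have [x Qx] : exists x : 'cV[R]_p, Q *m x = delta_mx i 0.
  by exists (Q^T *m delta_mx i 0); rewrite mulmxA QQ mul1mx.
have x0 : x != 0.
  apply/eqP => x0; move: Qx; rewrite x0 mulmx0 => /matrixP/(_ i 0).
  by rewrite !mxE !eqxx => /esym/eqP; rewrite oner_eq0.
have := Apos x x0; rewrite AE !mulmxA -(mulmxA _ Q x) Qx.
have -> : x^T *m Q^T = delta_mx 0 i by rewrite -trmx_mul Qx trmx_delta.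
by rewrite -rowE -colE !mxE eqxx mulr1n.
Qed.

(** [C] is a square root of [Theta] read off its spectral decomposition, and both bounds come from
    the eigenvalues lying between 0 and [lmax]. The entry bound will give [theta0 <= lmax / 2]. *)
Lemma posdef_whitening (Theta : 'M[R]_p) (lmax : R) : posdef Theta ->
  (forall a, eigenvalue Theta a -> a <= lmax) ->
  exists B C : 'M[R]_p, [/\ B *m C = 1%:M, C *m B = 1%:M, Theta = C^T *m C,
    forall m (G : 'M[R]_(m, p)), frob (G *m C) <= lmax * frob G &
    forall j k, j != k -> `|Theta j k| <= lmax / 2].
Proof.
move=> Tpos Tmax; have [Q [d [QQ Q'Q TE]]] := real_spectral Tpos.1.
have d0 := posdef_spectral Tpos QQ TE.
have dmax i : d 0 i <= lmax.
  apply: Tmax; apply/eigenvalueP; exists (row i Q).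
    rewrite TE -row_mul !mulmxA QQ mul1mx.
    by apply/rowP => j; rewrite mul_diag_mx !mxE.
  apply/eqP => rQ; have := congr1 (row i) QQ; rewrite row_mul rQ mul0mx.
  by move=> /rowP/(_ i); rewrite !mxE eqxx => /esym/eqP; rewrite oner_eq0.
pose s : 'rV[R]_p := \row_i Num.sqrt (d 0 i).
pose s' : 'rV[R]_p := \row_i (Num.sqrt (d 0 i))^-1.
have ss' : diag_mx s *m diag_mx s' = 1%:M.
  rewrite mulmx_diag; apply/matrixP => i j; rewrite !mxE divff//.
  by rewrite gt_eqF// sqrtr_gt0.
have s's : diag_mx s' *m diag_mx s = 1%:M by rewrite diag_mxC.
have ssd : diag_mx s *m diag_mx s = diag_mx d.
  rewrite mulmx_diag; congr diag_mx; apply/rowP => i; rewrite !mxE -expr2 sqr_sqrtr//.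
  exact: ltW.
exists (Q^T *m diag_mx s'), (diag_mx s *m Q); split.
- by rewrite mulmxA -(mulmxA Q^T) s's mulmx1.
- by rewrite mulmxA -(mulmxA _ Q) QQ mulmx1.
- by rewrite trmx_mul tr_diag_mx mulmxA -(mulmxA Q^T) ssd -TE.
- move=> m G; rewrite frobE !trmx_mul tr_diag_mx !mulmxA -(mulmxA _ Q Q^T) QQ mulmx1.
  rewrite -(mulmxA G) ssd mulr_sumr; apply: ler_sum => i _.
  rewrite mxE mulr_sumr; apply: ler_sum => j _; rewrite mul_mx_diag !mxE.
  by rewrite -mulrA mulrCA -expr2 ler_wpM2r ?sqr_ge0.
- move=> j k jk.
  (* Distinct columns of [Q] are orthogonal, so shifting the spectrum by [lmax / 2] leaves
     off-diagonal entries unchanged; the shifted eigenvalues are at most [lmax / 2] in absolute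
     value. *)
  have TjkE : Theta j k = \sum_i (d 0 i - lmax / 2) * (Q i j * Q i k).
    under eq_bigr do rewrite mulrBl.
    rewrite sumrB -mulr_sumr.
    have -> : \sum_i Q i j * Q i k = 0.
      have /matrixP/(_ j k) := Q'Q; rewrite !mxE (negPf jk) mulr0n => h.
      by rewrite -[RHS]h; apply: eq_bigr => i _; rewrite mxE.
    rewrite mulr0 subr0 TE -mulmxA mxE; apply: eq_bigr => i _.
    by rewrite mul_diag_mx !mxE mulrCA.
  have Q1 l : \sum_i Q i l ^+ 2 = 1.
    have /matrixP/(_ l l) := Q'Q; rewrite !mxE eqxx mulr1n => h.
    by rewrite -[RHS]h; apply: eq_bigr => i _; rewrite mxE expr2.
  rewrite TjkE; apply: le_trans (ler_norm_sum _ _ _) _.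
  have lE : lmax / 2 = \sum_i lmax / 2 * ((Q i j ^+ 2 + Q i k ^+ 2) / 2).
    by rewrite -mulr_sumr -mulr_suml big_split/= !Q1; field.
  rewrite [leRHS]lE.
  apply: ler_sum => i _; rewrite normrM; apply: ler_pM => //.
    rewrite ler_norml; have := d0 i; have := dmax i; move: (d 0 i) => x h1 h2.
    by apply/andP; split; lra.
  have := sqr_ge0 (Q i j - Q i k); have := sqr_ge0 (Q i j + Q i k).
  by rewrite ler_norml => h1 h2; apply/andP; split; nra.
Qed.

Lemma ln_prod (I : finType) (F : I -> R) : (forall i, 0 < F i) ->
  ln (\prod_i F i) = \sum_i ln (F i).
Proof.
move=> F0; suff [] : 0 < \prod_i F i /\ ln (\prod_i F i) = \sum_i ln (F i) by [].
elim/big_ind2: _ => [|x1 x2 y1 y2 [x10 <-] [y10 <-]|i _]; first by rewrite ln1.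
- by rewrite mulr_gt0// lnM ?posrE.
- by rewrite F0.
Qed.

(** Diagonalising [D] turns the ratio of determinants into the product of the [1 + d i], which are
    positive as eigenvalues of [B^T Theta B]. The deficit becomes the noise plus the sum of
    [d i - ln (1 + d i)]; [nu] is the noise level per unit of norm. *)
Lemma log_det_gap (Theta0 Theta B C S : 'M[R]_p) (r nu : R) :
  B *m C = 1%:M -> C *m B = 1%:M -> Theta0 = C^T *m C -> posdef Theta ->
  let D := B^T *m (Theta - Theta0) *m B in
  0 < r <= 3 / 4 -> r ^+ 2 <= frob D -> 0 <= r ^+ 2 / 4 - nu * r ->
  - (nu * Num.sqrt (frob D)) <= \tr ((S - B *m B^T) *m (Theta - Theta0)) ->
  r ^+ 2 / 4 - nu * r <=
    (ln (\det Theta0) - \tr (S *m Theta0)) - (ln (\det Theta) - \tr (S *m Theta)).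
Proof.
move=> BC CB T0E Tpos D /andP[r0 r34] rD gap0 noise.
have BTC : B^T *m C^T = 1%:M by rewrite -trmx_mul CB trmx1.
have BT0B : B^T *m Theta0 *m B = 1%:M.
  by rewrite T0E !mulmxA BTC mul1mx CB.
have DE : B^T *m Theta *m B = 1%:M + D.
  by rewrite /D mulmxBr mulmxBl BT0B addrC subrK.
have T0s : Theta0^T = Theta0 by rewrite T0E trmx_mul trmxK.
have Ts : (Theta - Theta0)^T = Theta - Theta0.
  by apply/matrixP => i j; rewrite -[in RHS]T0s -[in RHS]Tpos.1 !mxE.
have Ds : D^T = D by rewrite /D !trmx_mul trmxK Ts mulmxA.
have [Q [d [QQ Q'Q QDE]]] := real_spectral Ds.
have IDE : 1%:M + D = Q^T *m diag_mx (\row_i (1 + d 0 i)) *m Q.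
  have -> : diag_mx (\row_i (1 + d 0 i)) = 1%:M + diag_mx d.
    by apply/matrixP => i j; rewrite !mxE; case: eqP; rewrite ?mulr1n ?mulr0n ?addr0.
  by rewrite mulmxDr mulmx1 mulmxDl Q'Q -QDE.
have IDpos : posdef (1%:M + D).
  rewrite -DE; split; first by rewrite !trmx_mul trmxK Tpos.1 mulmxA.
  move=> x x0; have Bx0 : B *m x != 0.
    by apply: contra_neq x0 => Bx0; rewrite -[x]mul1mx -CB -mulmxA Bx0 mulmx0.
  by have := Tpos.2 _ Bx0; rewrite trmx_mul !mulmxA.
have d1 i : 0 < 1 + d 0 i by have := posdef_spectral IDpos QQ IDE i; rewrite mxE.
have detQ : \det Q^T * \det Q = 1 by rewrite -det_mulmx Q'Q det1.
have detID : \det (1%:M + D) = \prod_i (1 + d 0 i).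
  rewrite IDE !det_mulmx mulrAC detQ mul1r det_diag.
  by apply: eq_bigr => i _; rewrite mxE.
have detB : \det B ^+ 2 * \det Theta0 = 1.
  by rewrite -[RHS](det1 R p) -BT0B !det_mulmx det_tr; ring.
have detT : \det B ^+ 2 * \det Theta = \prod_i (1 + d 0 i).
  by rewrite -detID -DE !det_mulmx det_tr; ring.
have pr0 : 0 < \prod_i (1 + d 0 i) by exact: prodr_gt0.
have B2 : 0 < \det B ^+ 2.
  by rewrite exprn_even_gt0//=; apply/eqP => B0; move/eqP: detB;
    rewrite B0 expr0n mul0r eq_sym oner_eq0.
have T00 : 0 < \det Theta0 by rewrite -(pmulr_rgt0 _ B2) detB.
have T0 : 0 < \det Theta by rewrite -(pmulr_rgt0 _ B2) detT.
have lnE : ln (\det Theta) = ln (\det Theta0) + \sum_i ln (1 + d 0 i).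
  have l1 : ln (\det B ^+ 2) + ln (\det Theta0) = 0 by rewrite -lnM ?posrE// detB ln1.
  have l2 : ln (\det B ^+ 2) + ln (\det Theta) = \sum_i ln (1 + d 0 i).
    by rewrite -lnM ?posrE// detT ln_prod.
  lra.
have trE : \tr (B *m B^T *m (Theta - Theta0)) = \sum_i d 0 i.
  rewrite -mulmxA mxtrace_mulC -/D QDE -mulmxA mxtrace_mulC -mulmxA QQ mulmx1.
  by rewrite mxtrace_diag.
have frobD : frob D = \sum_i d 0 i ^+ 2 by rewrite QDE frob_spectral.
set W := \tr _ in noise.
have -> : ln (\det Theta0) - \tr (S *m Theta0) - (ln (\det Theta) - \tr (S *m Theta)) =
    W + \sum_i (d 0 i - ln (1 + d 0 i)).
  have trB (M N : 'M[R]_p) : \tr (M - N) = \tr M - \tr N by rewrite raddfB.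
  by rewrite lnE /W mulmxBl trB trE mulmxBr trB sumrB; ring.
have fD0 : 0 < frob D by apply: lt_le_trans rD; rewrite exprn_gt0.
set w := Num.sqrt (frob D) in noise; have w0 : 0 < w by rewrite sqrtr_gt0.
have w2 : w ^+ 2 = frob D by rewrite sqr_sqrtr// ltW.
have rw : r <= w by rewrite -(gtr0_norm r0) -sqrtr_sqr ler_wsqrtr.
(* Parameter at which the ray from [Theta0] to [Theta] meets the sphere: the whitened difference has
   norm [t w = r] there, so every [|t d i|] is at most 3/4. *)
pose t := r / w; have t0 : 0 < t by rewrite divr_gt0.
have t1 : t <= 1 by rewrite ler_pdivrMr// mul1r.
have tw : t * w = r by rewrite divfK// gt_eqF.
clearbody t.
have td i : `|t * d 0 i| <= 3 / 4.
  apply: le_trans r34; rewrite -(gtr0_norm r0) -!sqrtr_sqr ler_wsqrtr//.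
  rewrite exprMn -tw exprMn ler_wpM2l ?sqr_ge0// w2 frobD.
  by rewrite (bigD1 i)//= lerDl sumr_ge0// => j _; exact: sqr_ge0.
have main : r ^+ 2 / 4 - nu * r <= t * (W + \sum_i (d 0 i - ln (1 + d 0 i))).
  rewrite mulrDr addrC; apply: lerD.
    by have := ler_wpM2l (ltW t0) noise; rewrite mulrN mulrCA tw.
  rewrite mulr_sumr -tw exprMn w2 frobD mulr_sumr mulr_suml; apply: ler_sum => i _.
  by rewrite -exprMn; apply: divergence_scale_ge; rewrite ?(ltW t0) ?t1.
(* Since the gap is nonnegative, so is [t] times the deficit, hence the deficit itself; as [t <= 1],
   the factor [t] can then be dropped. *)
apply: (le_trans main); rewrite -[leRHS]mul1r ler_wpM2r//.
by rewrite -(pmulr_rge0 _ t0); exact: le_trans main.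
Qed.

End Whitening.

(** * Projection on a sparse model and the noise along the two components *)

Section ModelProjection.
Variables (R : realType) (p : nat).

Lemma frob_mxvec (A : 'M[R]_p) : frob (mxvec A) = frob A.
Proof.
rewrite /frob big_ord_recl big_ord0 addr0 (reindex _ (curry_mxvec_bij _ _)) pair_bigA/=.
by apply: eq_bigr => -[i j] _ /=; rewrite mxvecE.
Qed.

Lemma frob_sub_orthogonal m (x y : 'rV[R]_m) : y *m x^T = 0 ->
  frob (x - y) = frob x + frob y.
Proof.
move=> yx; have xy : x *m y^T = 0 by rewrite -[LHS]trmxK trmx_mul trmxK yx trmx0.
rewrite !frobE -mxtraceD; congr (\tr _).
rewrite [(x - y)^T]linearB/= mulmxBl !mulmxBr xy yx.
by rewrite subr0 sub0r opprK.
Qed.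

(** The map [K] symmetrises an arbitrary matrix and masks it by [S], so it parametrises the model
    linearly. Projecting the whitened [M] on the range of its whitened version [L] gives [N], and
    [A - N] stays in that range, whence the Pythagorean identity. *)
Lemma model_projection (S : rel 'I_p) (B M : 'M[R]_p) : symmetric S ->
  exists N : 'M[R]_p, [/\ N^T = N, forall j k, ~~ S j k -> N j k = 0 &
    forall A : 'M[R]_p, A^T = A -> (forall j k, ~~ S j k -> A j k = 0) ->
      frob (B^T *m (A - M) *m B) =
      frob (B^T *m (A - N) *m B) + frob (B^T *m (M - N) *m B)].
Proof.
move=> Ss.
pose K (c : 'rV[R]_(p * p)) : 'M[R]_p :=
  \matrix_(j, k) if S j k then (vec_mx c j k + vec_mx c k j) / 2 else 0.
pose L (c : 'rV[R]_(p * p)) := mxvec (B^T *m K c *m B).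
have linK : linear K.
  move=> a u v; apply/matrixP => j k; rewrite !mxE.
  by case: ifP => _; rewrite ?mulr0 ?addr0//; field.
have linL : linear L.
  by move=> a u v; rewrite /L linK mulmxDr mulmxDl -scalemxAr -scalemxAl linearP.
pose Ll : {linear 'rV[R]_(p * p) -> 'rV[R]_(p * p)} :=
  HB.pack L (GRing.isLinear.Build R _ _ _ L linL).
pose U := lin1_mx Ll.
have UE c : c *m U = L c by rewrite /U mul_rV_lin1.
have KE (A : 'M[R]_p) : A^T = A -> (forall j k, ~~ S j k -> A j k = 0) -> K (mxvec A) = A.
  move=> As A0; apply/matrixP => j k; rewrite mxE mxvecK.
  have -> : A k j = A j k by rewrite -{1}As mxE.
  by case: ifP => [_|/negbT/A0 ->//]; field.
have [c cE] := row_space_projection U (mxvec (B^T *m M *m B)).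
have Ks : (K c)^T = K c.
  by apply/matrixP => j k; rewrite !mxE Ss addrC.
have K0 j k : ~~ S j k -> K c j k = 0 by move=> /negPf Sjk; rewrite mxE Sjk.
exists (K c); split=> // A As A0.
pose a := mxvec (A - K c).
have aE : a *m U = mxvec (B^T *m (A - K c) *m B).
  rewrite UE /L KE//; first by rewrite linearB/= As Ks.
  by move=> j k Sjk; rewrite mxE [X in _ + X]mxE A0// K0// subrr.
have yE : mxvec (B^T *m M *m B) - c *m U = mxvec (B^T *m (M - K c) *m B).
  by rewrite UE /L -linearB/= mulmxBr mulmxBl.
rewrite -!frob_mxvec -aE -yE -frob_sub_orthogonal; last first.
  by rewrite trmx_mul mulmxA cE mul0mx.
by rewrite aE yE -linearB/= -mulmxBl -mulmxBr opprB addrA subrK.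
Qed.

(** Cauchy-Schwarz against the indicator of [S], read off the nonnegative sum of the squares of
    [N |v x| - s]. *)
Lemma sqr_sum_norm_le (I : finType) (S : pred I) (v : I -> R) :
  (\sum_(x | S x) `|v x|) ^+ 2 <= #|S|%:R * \sum_(x | S x) v x ^+ 2.
Proof.
set s := \sum_(x | S x) _; set N : R := #|S|%:R; set Q := \sum_(x | S x) _.
have N0 : 0 <= N by exact: ler0n.
have [N00|Nn0] := eqVneq N 0.
  have s0 : s = 0.
    rewrite /s big_pred0// => x; apply/negbTE/negP => Sx.
    move/eqP: N00; rewrite pnatr_eq0 => /eqP/card0_eq/(_ x).
    by rewrite unfold_in Sx.
  by rewrite s0 N00 expr0n mul0r.
have Npos : 0 < N by rewrite lt_def Nn0.
have h : 0 <= \sum_(x | S x) (N * `|v x| - s) ^+ 2.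
  by apply: sumr_ge0 => x _; exact: sqr_ge0.
have hE : \sum_(x | S x) (N * `|v x| - s) ^+ 2 = N * (N * Q - s ^+ 2).
  have e x : S x -> (N * `|v x| - s) ^+ 2 =
      N ^+ 2 * v x ^+ 2 + (- (2 * N * s)) * `|v x| + s ^+ 2.
    by move=> _; rewrite -[v x ^+ 2]real_normK ?num_real//; ring.
  rewrite (eq_bigr _ e) !big_split/= -!mulr_sumr sumr_const -mulr_natl.
  by rewrite -/N -/s -/Q; ring.
by move: h; rewrite hE pmulr_rge0// subr_ge0.
Qed.

(** At most [q] edges are coded by [q] ordered pairs with repetition, so the union bound runs over a
    finite type with [p^(2q)] elements. The diagonal belongs to every support. *)
Definition support_rel (q : nat) (f : {ffun 'I_q -> 'I_p * 'I_p}) : rel 'I_p :=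
  fun j k => (j == k) || [exists i, (f i == (j, k)) || (f i == (k, j))].

Lemma support_rel_sym q (f : {ffun 'I_q -> 'I_p * 'I_p}) : symmetric (support_rel f).
Proof.
move=> j k; rewrite /support_rel eq_sym; congr (_ || _).
by apply: eq_existsb => i; rewrite orbC.
Qed.

Lemma card_support_rel q (f : {ffun 'I_q -> 'I_p * 'I_p}) :
  (#|[pred x : 'I_p * 'I_p | support_rel f x.1 x.2]| <= p + 2 * q)%N.
Proof.
pose D := [set (j, j) | j : 'I_p].
pose F1 := [set f i | i : 'I_q]; pose F2 := [set ((f i).2, (f i).1) | i : 'I_q].
have cD : (#|D| <= p)%N by rewrite -[leqRHS]card_ord leq_imset_card.
have c1 : (#|F1| <= q)%N by rewrite -[leqRHS]card_ord leq_imset_card.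
have c2 : (#|F2| <= q)%N by rewrite -[leqRHS]card_ord leq_imset_card.
apply: (@leq_trans #|D :|: (F1 :|: F2)|).
  apply: subset_leq_card; apply/fintype.subsetP => -[j k]; rewrite !inE /support_rel /=.
  case/orP => [/eqP ->|/existsP[i /orP[]/eqP fi]].
  - by rewrite imset_f.
  - by rewrite -fi [f i \in F1]imset_f// orbT.
  - have -> : (j, k) \in F2 by apply/imsetP; exists i; rewrite ?fi.
    by rewrite !orbT.
apply: leq_trans (leq_card_setU _ _) _.
rewrite leq_add// mul2n -addnn; apply: leq_trans (leq_card_setU _ _) _.
by rewrite leq_add.
Qed.

Lemma edge_set_support q (E : {set {set 'I_p}}) : (0 < p)%N -> edge_set E ->
  (#|E| <= q)%N -> exists f : {ffun 'I_q -> 'I_p * 'I_p},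
  forall j k, j != k -> [set j; k]%SET \in E -> support_rel f j k.
Proof.
move=> p0 Ee Eq; pose j0 := Ordinal p0.
(* Positions beyond the number of edges get the default pair [(j0, j0)], which lies on the diagonal
   and does not enlarge the support. *)
pose pick_pair (e : {set 'I_p}) : 'I_p * 'I_p :=
  odflt (j0, j0) [pick x | e == [set x.1; x.2]%SET].
exists [ffun i : 'I_q => pick_pair (nth finset.set0 (enum E) i)] => j k jk jkE.
apply/orP; right; apply/existsP.
have iE : (index [set j; k]%SET (enum E) < q)%N.
  by apply: leq_trans Eq; rewrite cardE index_mem mem_enum.
exists (Ordinal iE); rewrite ffunE /= nth_index ?mem_enum//.
rewrite /pick_pair; case: pickP => [[a b] /= /eqP jkab|/(_ (j, k))]; last first.
  by rewrite /= eqxx.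
have ja : j \in [set a; b]%SET by rewrite -jkab set21.
have ka : k \in [set a; b]%SET by rewrite -jkab set22.
move: ja ka jk; rewrite !in_set2.
case/orP => /eqP -> /orP[]/eqP ->; rewrite ?eqxx// => _.
by rewrite orbT.
Qed.

Lemma entrywise_noise_bound (S : rel 'I_p) (W A : 'M[R]_p) (delta : R) :
  0 <= delta -> (forall j k, `|W j k| <= delta) -> (forall j k, ~~ S j k -> A j k = 0) ->
  `|\tr (W *m A)| <= delta * \sum_(x : 'I_p * 'I_p | S x.1 x.2) `|A x.1 x.2|.
Proof.
move=> d0 Wd A0.
have -> : \tr (W *m A) = \sum_(x : 'I_p * 'I_p | S x.1 x.2) W x.2 x.1 * A x.1 x.2.
  rewrite /mxtrace; under eq_bigr do rewrite mxE.
  rewrite exchange_big pair_bigA [LHS](bigID (fun x => S x.1 x.2))/=.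
  by rewrite [X in _ + X]big1 ?addr0// => x Sx; rewrite A0// mulr0.
apply: le_trans (ler_norm_sum _ _ _) _; rewrite mulr_sumr; apply: ler_sum => x _.
by rewrite normrM ler_wpM2r.
Qed.

Lemma frob_congruence_le (B C : 'M[R]_p) (lmax : R) (A : 'M[R]_p) : 0 <= lmax ->
  B *m C = 1%:M -> (forall m (G : 'M[R]_(m, p)), frob (G *m C) <= lmax * frob G) ->
  frob A <= lmax ^+ 2 * frob (B^T *m A *m B).
Proof.
move=> l0 BC hC; have CB : C^T *m B^T = 1%:M by rewrite -trmx_mul BC trmx1.
have {1}-> : A = C^T *m (B^T *m A *m B) *m C.
  by rewrite !mulmxA CB mul1mx -mulmxA BC mulmx1.
apply: le_trans (hC _ _) _; rewrite expr2 -mulrA ler_wpM2l//.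
by rewrite -frob_tr trmx_mul trmxK; apply: le_trans (hC _ _) _; rewrite frob_tr.
Qed.

(** [A - Theta0] is the sparse [A - N] minus the residual [Theta0 - N]. The first pairs with [W]
    entry by entry; the second enters with a minus sign, so an upper bound on its trace is the one
    required. *)
Lemma noise_bound (S : rel 'I_p) (K : nat) (B C Theta0 N W A : 'M[R]_p)
    (lmax delta tau : R) :
  0 <= lmax -> 0 <= delta -> 0 <= tau ->
  B *m C = 1%:M -> (forall m (G : 'M[R]_(m, p)), frob (G *m C) <= lmax * frob G) ->
  (#|[pred x : 'I_p * 'I_p | S x.1 x.2]| <= K)%N ->
  (forall j k, ~~ S j k -> N j k = 0) -> (forall j k, ~~ S j k -> A j k = 0) ->
  (forall j k, `|W j k| <= delta) ->
  \tr (W *m (Theta0 - N)) <= tau * Num.sqrt (frob (B^T *m (Theta0 - N) *m B)) ->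
  frob (B^T *m (A - Theta0) *m B) =
    frob (B^T *m (A - N) *m B) + frob (B^T *m (Theta0 - N) *m B) ->
  - (Num.sqrt (delta ^+ 2 * K%:R * lmax ^+ 2 + tau ^+ 2)
     * Num.sqrt (frob (B^T *m (A - Theta0) *m B))) <= \tr (W *m (A - Theta0)).
Proof.
move=> l0 d0 t0 BC hC SK N0 A0 Wd Wt pyth.
have AN0 j k : ~~ S j k -> (A - N) j k = 0.
  by move=> Sjk; rewrite !mxE A0// N0// subrr.
have := entrywise_noise_bound d0 Wd AN0; set s := \sum_(x | _) _ => h1.
set a := frob (B^T *m (A - N) *m B) in pyth *.
set b := frob (B^T *m (Theta0 - N) *m B) in pyth Wt *.
have a0 : 0 <= a by exact: frob_ge0.
have b0 : 0 <= b by exact: frob_ge0.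
set k1 := delta ^+ 2 * K%:R * lmax ^+ 2.
have k10 : 0 <= k1 by rewrite !mulr_ge0// sqr_ge0.
have s0 : 0 <= s by apply: sumr_ge0.
have s2 : s ^+ 2 <= K%:R * (lmax ^+ 2 * a).
  apply: (le_trans (sqr_sum_norm_le (fun x => S x.1 x.2) (fun x => (A - N) x.1 x.2))).
  apply: ler_pM => //.
  - by apply: sumr_ge0 => x _; exact: sqr_ge0.
  - by rewrite ler_nat.
  - apply: le_trans (frob_congruence_le (A - N) l0 BC hC).
    rewrite /frob pair_bigA/= [leRHS](bigID (fun x => S x.1 x.2))/= lerDl.
    by apply: sumr_ge0 => x _; exact: sqr_ge0.
set x := delta * s; have x0 : 0 <= x by rewrite mulr_ge0.
have x2 : x ^+ 2 <= k1 * a.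
  have -> : k1 * a = delta ^+ 2 * (K%:R * (lmax ^+ 2 * a)) by rewrite /k1 -!mulrA.
  by rewrite exprMn; apply: ler_wpM2l => //; exact: sqr_ge0.
set y := tau * Num.sqrt b; have y0 : 0 <= y by rewrite mulr_ge0 ?sqrtr_ge0.
have y2 : y ^+ 2 = tau ^+ 2 * b by rewrite exprMn sqr_sqrtr.
have trB (M M' : 'M[R]_p) : \tr (W *m (M - M')) = \tr (W *m M) - \tr (W *m M').
  by rewrite mulmxBr raddfB.
have -> : \tr (W *m (A - Theta0)) = \tr (W *m (A - N)) - \tr (W *m (Theta0 - N)).
  by rewrite !trB; ring.
rewrite -sqrtrM ?addr_ge0 ?sqr_ge0// pyth.
(* Cauchy-Schwarz in the plane from [x ^ 2 <= k1 a] and [y ^ 2 = tau ^ 2 b]; the cross term [2 x y]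
   is at most [k1 b + tau ^ 2 a] by the inequality of arithmetic and geometric means. *)
have xy : x + y <= Num.sqrt ((k1 + tau ^+ 2) * (a + b)).
  rewrite -(ger0_norm (addr_ge0 x0 y0)) -sqrtr_sqr ler_wsqrtr//.
  have t20 := sqr_ge0 tau.
  have h : (2 * (x * y)) ^+ 2 <= (k1 * b + tau ^+ 2 * a) ^+ 2.
    have h' : (x * y) ^+ 2 <= k1 * a * (tau ^+ 2 * b).
      by rewrite exprMn y2 ler_wpM2r// mulr_ge0.
    apply: (@le_trans _ _ (4 * (k1 * a * (tau ^+ 2 * b)))).
      by rewrite exprMn (_ : 2 ^+ 2 = 4) ?ler_wpM2l// -natrX.
    by have := sqr_ge0 (k1 * b - tau ^+ 2 * a); nra.
  have {}h : 2 * (x * y) <= k1 * b + tau ^+ 2 * a.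
    rewrite -(ger0_norm (_ : 0 <= 2 * (x * y))) ?mulr_ge0// -sqrtr_sqr.
    rewrite -[leRHS]ger0_norm ?addr_ge0 ?mulr_ge0// -sqrtr_sqr.
    exact: ler_wsqrtr.
  by rewrite sqrrD y2; move: x2 h; nra.
move: h1 Wt xy; rewrite ler_norml -/x -/y => /andP[h1 _] Wt xy.
move: (Num.sqrt _) xy => z xy; lra.
Qed.

End ModelProjection.

(** * Deviations of the sample covariance *)

Section MatrixTail.
Context (R : realType) d (T : measurableType d) (P : probability T R) (n p : nat).
Variables (X : 'I_n -> 'I_p -> T -> R) (B C : 'M[R]_p).
Hypotheses (n0 : (0 < n)%N) (BC : B *m C = 1%:M) (CB : C *m B = 1%:M).
Hypothesis iid : iid_gaussian P (B *m B^T) X.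

Lemma trace_sample_cov (M : 'M[R]_p) t :
  \tr (sample_cov X t *m M) =
  n%:R^-1 * \sum_i ((sample_vec X i t)^T *m M *m sample_vec X i t) 0 0.
Proof.
rewrite /sample_cov -scalemxAl mxtraceZ mulmx_suml raddf_sum; congr (_ * _).
apply: eq_bigr => i _; rewrite /= -mulmxA mxtrace_mulC -mulmxA.
by rewrite [LHS](_ : _ = \tr ((sample_vec X i t)^T *m (M *m sample_vec X i t)))
  ?mulmxA /mxtrace ?big_ord_recl ?big_ord0 ?addr0// -mulmxA.
Qed.

Definition deviation (M : 'M[R]_p) t := \tr ((sample_cov X t - B *m B^T) *m M).

(** [C X_i] is standard normal; rotating it by the eigenvectors of [B^T M B] makes the form diagonal
    with the eigenvalues [m] as weights, and [frob] of that matrix is the sum of their squares. *)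
Lemma deviation_tail (M : 'M[R]_p) (tau : R) : M^T = M -> 0 <= tau <= 1 ->
  let E := [set t | tau * Num.sqrt (frob (B^T *m M *m B)) < deviation M t] in
  measurable E /\ (P E <= (2 * expR (- (n%:R * tau ^+ 2 / 32)))%:E)%E.
Proof.
move=> Ms tau01; case: iid => mX indep law.
pose D := B^T *m M *m B.
have Ds : D^T = D by rewrite /D !trmx_mul trmxK Ms mulmxA.
have [Q [m [QQ Q'Q DE]]] := real_spectral Ds.
have CTBT : C^T *m B^T = 1%:M by rewrite -trmx_mul BC trmx1.
have ME : M = C^T *m D *m C.
  by rewrite /D !mulmxA CTBT mul1mx -mulmxA BC mulmx1.
pose A := C^T *m Q^T.
have zE i t : A^T *m sample_vec X i t = \col_j whitened X A i j t.
  by apply/colP => j; rewrite !mxE; apply: eq_bigr => k _; rewrite !mxE.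
have qE i t : ((sample_vec X i t)^T *m M *m sample_vec X i t) 0 0 =
    quad (whitened X A i) (m 0) t.
  have -> : (sample_vec X i t)^T *m M *m sample_vec X i t =
      (A^T *m sample_vec X i t)^T *m (diag_mx m *m (A^T *m sample_vec X i t)).
    by rewrite ME {1}DE /A !trmx_mul !trmxK !mulmxA.
  rewrite zE mxE; apply: eq_bigr => j _.
  by rewrite mul_diag_mx !mxE mulrCA -expr2.
have trD : \tr (B *m B^T *m M) = \sum_j m 0 j.
  by rewrite -mulmxA mxtrace_mulC -/D DE -mulmxA mxtrace_mulC -mulmxA QQ mulmx1 mxtrace_diag.
have frobD : frob D = \sum_j m 0 j ^+ 2 by rewrite DE frob_spectral.
have n0R : 0 < n%:R :> R by rewrite ltr0n.
have devE t : n%:R * deviation M t = form_deviation X A (m 0) t.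
  rewrite /deviation mulmxBl raddfB/= trD trace_sample_cov mulrBr mulrA mulfV ?gt_eqF// mul1r.
  under eq_bigr do rewrite qE.
  by rewrite /form_deviation sumrB sumr_const card_ord mulr_natl.
have std i (b : 'I_p -> R) : \sum_j b j ^+ 2 = 1 ->
  forall S : set R, measurable S ->
    P [set t | S (\sum_j b j * whitened X A i j t)] = normal_prob 0 1 S.
  move=> b1 S mS; pose v : 'cV[R]_p := \col_j b j.
  have vv : v^T *m v = 1%:M.
    apply/matrixP => a c; rewrite !ord1 !mxE eqxx -[RHS]b1; apply: eq_bigr => j _.
    by rewrite !mxE expr2.
  have va : (A *m v)^T *m (B *m B^T) *m (A *m v) = 1%:M.
    rewrite /A !trmx_mul !trmxK !mulmxA -(mulmxA _ C B) CB mulmx1.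
    rewrite -(mulmxA _ B^T C^T) -trmx_mul CB trmx1 mulmx1.
    by rewrite -(mulmxA _ Q Q^T) QQ mulmx1.
  have Av0 : A *m v != 0.
    apply/eqP => Av0; move: va; rewrite Av0 mulmx0 => /matrixP/(_ 0 0).
    by rewrite !mxE eqxx => /esym/eqP; rewrite oner_eq0.
  have := law i (A *m v) Av0 S mS; rewrite va mxE eqxx sqrtr1 => <-.
  have fE t : ((A *m v)^T *m sample_vec X i t) ord0 ord0 =
      \sum_j b j * whitened X A i j t.
    by rewrite trmx_mul -mulmxA zE mxE; apply: eq_bigr => j _; rewrite !mxE.
  by congr (P _); apply/seteqP; split=> t /=; rewrite fE.
pose F := frob D.
have EE : [set t | tau * Num.sqrt F < deviation M t] =
    [set t | n%:R * (tau * Num.sqrt F) < form_deviation X A (m 0) t].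
  by apply/seteqP; split=> t /=; rewrite -devE ltr_pM2l.
rewrite /= -/D -/F EE.
have mdev := measurable_form_deviation A mX (m 0).
have mE : measurable [set t | n%:R * (tau * Num.sqrt F) < form_deviation X A (m 0) t].
  rewrite (_ : [set t | _] = form_deviation X A (m 0) @^-1`
    `]n%:R * (tau * Num.sqrt F), +oo[%classic).
    by rewrite -[X in measurable X]setTI; exact: mdev.
  by apply/seteqP; split=> t /=; rewrite in_itv/= andbT.
split=> //; have [F0|F0] := eqVneq F 0.
  (* Norm zero forces [M = 0], and the strict inequality makes the event empty. *)
  rewrite -EE (_ : [set t | _] = set0) ?measure0 ?lee_fin ?mulr_ge0 ?expR_ge0//.
  have M0 : M = 0 by rewrite ME (frob_eq0 F0) mulmx0 mul0mx.
  apply/seteqP; split=> // t /=.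
  by rewrite /deviation M0 mulmx0 mxtrace0 F0 sqrtr0 mulr0 ltxx.
have Fpos : 0 < F by rewrite lt_def F0 frob_ge0.
have tail := form_tail (A := A) mX indep std (esym frobD) Fpos tau01.
apply: le_trans tail; apply: le_measure; rewrite ?inE//.
- rewrite (_ : [set t | _] = form_deviation X A (m 0) @^-1`
    `[n%:R * (tau * Num.sqrt F), +oo[%classic).
    by rewrite -[X in measurable X]setTI; exact: mdev.
  by apply/seteqP; split=> t /=; rewrite in_itv/= andbT.
- by move=> t /= /ltW.
Qed.

Lemma sample_cov_tr t : (sample_cov X t)^T = sample_cov X t.
Proof.
rewrite /sample_cov linearZ/= linear_sum/=; congr (_ *: _).
by apply: eq_bigr => i _; rewrite trmx_mul trmxK.
Qed.

(** Symmetrised elementary matrices make entries of the sample covariance instances of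
    [deviation_tail]; the sign [sg] lets one-sided events control absolute values. *)
Lemma deviation_entry (sg : R) j k t :
  deviation (sg *: (2^-1 *: (delta_mx j k + delta_mx k j))) t =
  sg * (sample_cov X t - B *m B^T) j k.
Proof.
rewrite /deviation; set W := _ - _.
have Ws : W^T = W by rewrite /W linearB/= sample_cov_tr trmx_mul trmxK.
have trd a b : \tr (W *m delta_mx a b) = W b a.
  rewrite -(mul_delta_mx (0 : 'I_1)) mulmxA mxtrace_mulC -rowE -colE.
  by rewrite /mxtrace big_ord1 !mxE.
rewrite -scalemxAr mxtraceZ -scalemxAr mxtraceZ mulmxDr mxtraceD !trd.
have -> : W k j = W j k by rewrite -{1}Ws mxE.
by congr (_ * _); field.
Qed.

(** Entrywise [((x + y) / 2) ^ 2 <= (x ^ 2 + y ^ 2) / 2], after which the double sums factor. It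
    makes the entrywise deviation scale with the largest variance. *)
Lemma frob_entry (sg : R) j k : sg ^+ 2 = 1 ->
  frob (B^T *m (sg *: (2^-1 *: (delta_mx j k + delta_mx k j))) *m B)
  <= (B *m B^T) j j * (B *m B^T) k k.
Proof.
move=> sg2.
have E a b : (B^T *m (sg *: (2^-1 *: (delta_mx j k + delta_mx k j))) *m B) a b =
    sg * ((B j a * B k b + B k a * B j b) / 2).
  rewrite -scalemxAr -scalemxAr -!scalemxAl mxE [X in _ * X]mxE mulmxDr mulmxDl.
  have e i l : (B^T *m delta_mx i l *m B) a b = B i a * B l b.
    rewrite -(mul_delta_mx (0 : 'I_1)) !mulmxA -colE -mulmxA -rowE mxE big_ord1.
    by rewrite !mxE.
  by rewrite [X in _ * (_ * X)]mxE !e; congr (_ * _); rewrite mulrC.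
rewrite /frob; have BB l : (B *m B^T) l l = \sum_a B l a ^+ 2.
  by rewrite mxE; apply: eq_bigr => a _; rewrite mxE expr2.
apply: (@le_trans _ _ (\sum_a \sum_b (B j a ^+ 2 * B k b ^+ 2 + B k a ^+ 2 * B j b ^+ 2) / 2)).
  apply: ler_sum => a _; apply: ler_sum => b _; rewrite E exprMn sg2 mul1r.
  by have := sqr_ge0 (B j a * B k b - B k a * B j b); rewrite -!exprMn; nra.
under eq_bigr do rewrite -mulr_suml big_split/= -!mulr_sumr.
rewrite -mulr_suml big_split/= -!mulr_suml !BB le_eqVlt; apply/orP; left; apply/eqP.
by field.
Qed.

End MatrixTail.

Lemma measure_bigsetU_le_card d (T : measurableType d) (R : realType)
  (P : probability T R) (I : finType) (A : I -> set T) (c : R) :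
  (forall i, measurable (A i)) -> (forall i, (P (A i) <= c%:E)%E) ->
  measurable (\big[setU/set0]_i A i) /\ (P (\big[setU/set0]_i A i) <= (#|I|%:R * c)%:E)%E.
Proof.
move=> mA PA; split; first by apply: bigsetU_measurable => i _.
have -> : #|I|%:R * c = \sum_(i : I) c by rewrite sumr_const mulr_natl.
rewrite -sumEFin.
suff [_ //] : measurable (\big[setU/set0]_i A i) /\
  (P (\big[setU/set0]_i A i) <= \sum_(i : I) c%:E)%E.
elim/big_rec2: _ => [|i y U _ [mU PU]]; first by rewrite measure0.
split; first exact: measurableU.
by apply: (le_trans (measureU2 P (mA i) mU)); exact: (leeD (PA i) PU).
Qed.

(** * Numerical inequalities behind the constants *)

Section Numerics.
Variable R : realType.

(** Converts a probability of order [p^-3] into the stated prefactor. From [pi <= 4] and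
    [ln x <= x - 1] there remains [4 (x - 1) <= (x ^ 3 / 4) ^ 2], an equality at [x = 2]. *)
Lemma sqrt_pi_ln_le (x : R) : 2 <= x -> Num.sqrt (pi * ln x) <= x ^+ 3 / 4.
Proof.
move=> x2; have x0 : 0 < x by lra.
have pi4 : pi <= 4 :> R.
  by have := @pihalf_lt2 R; rewrite ltr_pdivrMr//; lra.
have ln0 : 0 <= ln x by rewrite ln_ge0//; lra.
have lnx : ln x <= x - 1.
  by have h := @ln_le_tangent R 1 x ltr01 x0; move: h; rewrite ln1 divr1 add0r.
have h1 : pi * ln x <= 4 * (x - 1) by apply: ler_pM => //; rewrite pi_ge0.
have h2 : 4 * (x - 1) <= (x ^+ 3 / 4) ^+ 2.
  have s1 : x - 1 <= x ^+ 2 / 4 by have := sqr_ge0 (x - 2); nra.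
  have s2 : 1 <= x ^+ 2 / 4 by nra.
  have s3 : 1 <= (x ^+ 2 / 4) ^+ 2 by rewrite exprn_ege1.
  have -> : (x ^+ 3 / 4) ^+ 2 = 4 * (x ^+ 2 / 4 * (x ^+ 2 / 4) ^+ 2) by field.
  rewrite ler_pM2l// -[leLHS]mulr1; apply: ler_pM => //; lra.
have x30 : 0 <= x ^+ 3 / 4 by rewrite divr_ge0// exprn_ge0// ltW.
by rewrite -[leRHS]ger0_norm// -sqrtr_sqr ler_wsqrtr//; exact: le_trans h2.
Qed.

(** The [2 p^2] signed entries contribute [4 p^(-4-eps)] and the [p^(2q)] codes of supports
    contribute [2 p^(-3-eps)]; as [p >= 2], the total is at most [4 p^(-3-eps)]. *)
Lemma failure_bound (p q : nat) (eps : R) : (2 <= p)%N -> 0 < eps ->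
  #|{: 'I_p * 'I_p * bool}|%:R * (2 * expR (- ((6 + eps) * ln p%:R))) +
  #|{ffun 'I_q -> 'I_p * 'I_p}|%:R * (2 * expR (- ((2 * q%:R + 3 + eps) * ln p%:R)))
  <= (Num.sqrt (pi * ln p%:R))^-1 * (p%:R `^ (- eps)).
Proof.
move=> p2 eps0; rewrite !card_prod card_bool card_ffun card_prod !card_ord.
set x : R := p%:R; have x2 : 2 <= x by rewrite /x ler_nat.
have x0 : 0 < x by lra.
set L := ln x; have L0 : 0 < L by rewrite ln_gt0//; lra.
have expL : expR (- L) = x^-1 by rewrite expRN lnK ?posrE.
have -> : x `^ (- eps) = expR (- eps * L) by rewrite /powR gt_eqF.
set e := x^-1; set E := expR (- eps * L); have E0 : 0 <= E by exact: expR_ge0.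
have e0 : 0 < e by rewrite invr_gt0.
have e2 : e <= 2^-1 by rewrite lef_pV2 ?posrE.
have xe : x * e = 1 by rewrite mulfV// gt_eqF.
have expk k : expR (- (k%:R * L)) = e ^+ k.
  by rewrite /e -expL -expRM_natl mulrN.
have -> : expR (- ((6 + eps) * L)) = e ^+ 6 * E.
  by rewrite -expk -expRD; congr expR; ring.
have -> : expR (- ((2 * q%:R + 3 + eps) * L)) = (e ^+ 2) ^+ q * e ^+ 3 * E.
  by rewrite -exprM -!expk -!expRD natrM; congr expR; ring.
have -> : (p * p * 2)%:R * (2 * (e ^+ 6 * E)) = 4 * e ^+ 4 * E.
  rewrite !natrM -/x.
  have -> : x * x * 2 * (2 * (e ^+ 6 * E)) = 4 * e ^+ 4 * E * (x * e) ^+ 2 by ring.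
  by rewrite xe expr1n mulr1.
have -> : ((p * p) ^ q)%:R * (2 * ((e ^+ 2) ^+ q * e ^+ 3 * E)) = 2 * e ^+ 3 * E.
  rewrite natrX natrM -/x.
  have -> : (x * x) ^+ q * (2 * ((e ^+ 2) ^+ q * e ^+ 3 * E)) =
      2 * e ^+ 3 * E * ((x * x) ^+ q * (e ^+ 2) ^+ q) by ring.
  have xe2 : x * x * e ^+ 2 = 1.
    have -> : x * x * e ^+ 2 = (x * e) ^+ 2 by ring.
    by rewrite xe expr1n.
  by rewrite -exprMn xe2 expr1n mulr1.
rewrite -mulrDl ler_wpM2r//.
have s0 : 0 < Num.sqrt (pi * L) by rewrite sqrtr_gt0 mulr_gt0// pi_gt0.
apply: (@le_trans _ _ (x ^+ 3 / 4)^-1); last first.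
  rewrite lef_pV2 ?posrE//; first exact: sqrt_pi_ln_le.
  by rewrite divr_gt0// exprn_gt0.
have -> : (x ^+ 3 / 4)^-1 = 4 * e ^+ 3 by rewrite invf_div -exprVn.
have -> : 4 * e ^+ 4 = 4 * e * e ^+ 3 by ring.
have e3 : 0 <= e ^+ 3 by rewrite exprn_ge0// ltW.
by rewrite -mulrDl ler_wpM2r//; lra.
Qed.

(** Everything is compared with [w = (1 + eps / 2) k rho], where [k = s + 2 q >= 4]. The entrywise
    part is at most [192 c w] and [tau2 ^ 2] at most [40 w], with [c = C ^ 2 >= 1]; their sum
    [232 c w] is at most 232/3200 of [theta ^ 2 / lam ^ 2], below the 2/25 allowed. *)
Lemma noise_budget (s q L n lam theta C sigma eps tau1 tau2 : R) :
  1 <= q -> 2 <= s -> 0 < L -> 0 < n -> 0 < lam -> 0 < theta -> 0 < eps ->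
  0 <= sigma -> 1 <= sigma * lam -> sigma * lam <= C ->
  tau1 ^+ 2 = 32 * (6 + eps) * L / n -> tau2 ^+ 2 = 32 * (2 * q + 3 + eps) * L / n ->
  50 * 64 * ((1 + eps / 2) * C ^+ 2) * ((s + 2 * q) * L / n) <= theta ^+ 2 / lam ^+ 2 ->
  theta ^+ 2 / lam ^+ 2 <= 1 / 4 ->
  [/\ tau1 ^+ 2 <= 1, tau2 ^+ 2 <= 1 &
    (tau1 * sigma) ^+ 2 * (s + 2 * q) * lam ^+ 2 + tau2 ^+ 2
      <= 2 * (theta ^+ 2 / lam ^+ 2) / 25].
Proof.
move=> q1 s2 L0 n0 lam0 th0 eps0 sg0 sl1 slC t1E t2E.
set rho := L / n; have rho0 : 0 <= rho by rewrite divr_ge0// ltW.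
set h := theta ^+ 2 / lam ^+ 2.
have C2 : 1 <= C ^+ 2 by rewrite exprn_ege1//; lra.
set c := C ^+ 2 in C2 *; set k := s + 2 * q; have k4 : 4 <= k by rewrite /k; lra.
have -> : (s + 2 * q) * L / n = k * rho by rewrite /k /rho mulrA.
move=> H h4; have {}t1E : tau1 ^+ 2 = 32 * (6 + eps) * rho by rewrite t1E /rho mulrA.
have {}t2E : tau2 ^+ 2 = 32 * (2 * q + 3 + eps) * rho by rewrite t2E /rho mulrA.
pose w := (1 + eps / 2) * k * rho.
have w0 : 0 <= w by apply: mulr_ge0 => //; apply: mulr_ge0; lra.
have wc : w <= c * w by rewrite ler_peMl.
have Hw : 50 * 64 * (c * w) <= h.
  by have -> : 50 * 64 * (c * w) = 50 * 64 * ((1 + eps / 2) * c) * (k * rho) by rewrite /w; ring.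
have b1 : tau1 ^+ 2 <= 48 * w.
  have -> : 48 * w = 48 * ((1 + eps / 2) * k) * rho by rewrite /w; ring.
  by rewrite t1E ler_wpM2r//; nra.
have b2 : tau2 ^+ 2 <= 40 * w.
  have -> : 40 * w = 40 * ((1 + eps / 2) * k) * rho by rewrite /w; ring.
  by rewrite t2E ler_wpM2r// /k; nra.
split; [lra|lra|].
have sl2 : (sigma * lam) ^+ 2 <= c.
  by rewrite /c lerXn2r// nnegrE; lra.
have -> : (tau1 * sigma) ^+ 2 * k * lam ^+ 2 = (sigma * lam) ^+ 2 * (tau1 ^+ 2 * k) by ring.
have b3 : (sigma * lam) ^+ 2 * (tau1 ^+ 2 * k) <= c * (192 * w).
  apply: ler_pM => //; rewrite ?sqr_ge0//.
    by rewrite mulr_ge0 ?sqr_ge0//; lra.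
  rewrite t1E /w.
  have -> : 32 * (6 + eps) * rho * k = 32 * (6 + eps) * (k * rho) by ring.
  have -> : 192 * ((1 + eps / 2) * k * rho) = 192 * (1 + eps / 2) * (k * rho) by ring.
  by apply: ler_wpM2r; [apply: mulr_ge0 => //; lra|lra].
lra.
Qed.

Lemma signal_rescale (c lam rho theta : R) : 0 < c -> 0 < lam -> 0 < theta ->
  rho * (lam ^+ 2 / theta ^+ 2) <= c^-1 -> c * rho <= theta ^+ 2 / lam ^+ 2.
Proof.
move=> c0 l0 t0; rewrite -[lam ^+ 2 / _]invf_div -ler_pdivlMr ?invr_gt0 ?divr_gt0 ?exprn_gt0//.
by rewrite invrK ler_pdivlMl.
Qed.

End Numerics.

(** * The theorem *)

(** An edge of [E0] outside [E] is a zero of [Theta] at both [(j, k)] and [(k, j)], whence the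
    factor 2. *)
Lemma frob_diff_ge (R : realType) (p : nat) (E0 E : {set {set 'I_p}})
  (Theta0 Theta : 'M[R]_p) (theta0 : R) : edge_set E0 -> ~~ (E0 \subset E) ->
  0 <= theta0 -> posdef Theta0 -> in_model E Theta ->
  (forall j k : 'I_p, j != k -> [set j; k]%SET \in E0 -> theta0 <= `|Theta0 j k|) ->
  2 * theta0 ^+ 2 <= frob (Theta - Theta0).
Proof.
move=> E0e /subsetPn[e eE0 eE] th0 [T0s _] [[_ _] TE] T0min.
have /eqP/cards2P[j [k [jk ejk]]] := E0e e eE0.
have Tjk : Theta j k = 0 by apply: TE => //; rewrite -ejk.
have Tkj : Theta k j = 0.
  by apply: TE; rewrite 1?eq_sym// finset.setUC -ejk.
have m1 : theta0 <= `|Theta0 j k| by apply: T0min => //; rewrite -ejk.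
have T0kj : Theta0 k j = Theta0 j k by rewrite -{1}T0s mxE.
have sq : theta0 ^+ 2 <= Theta0 j k ^+ 2.
  by rewrite -(real_normK (num_real (Theta0 j k))) lerXn2r ?nnegrE.
rewrite /frob (bigD1 j)//= (bigD1 k)//= [X in _ <= _ + X](bigD1 k)/=; last first.
  by rewrite eq_sym.
rewrite [X in _ <= _ + (X + _)](bigD1 j)//=.
have n1 : 0 <= \sum_(i | i != k) (Theta - Theta0) j i ^+ 2.
  by apply: sumr_ge0 => i _; exact: sqr_ge0.
have n2 : 0 <= \sum_(i | i != j) (Theta - Theta0) k i ^+ 2.
  by apply: sumr_ge0 => i _; exact: sqr_ge0.
have n3 : 0 <= \sum_(i | (i != j) && (i != k)) \sum_l (Theta - Theta0) i l ^+ 2.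
  by apply: sumr_ge0 => i _; apply: sumr_ge0 => l _; exact: sqr_ge0.
have e1 : (Theta - Theta0) j k ^+ 2 = Theta0 j k ^+ 2.
  by rewrite !mxE Tjk sub0r sqrrN.
have e2 : (Theta - Theta0) k j ^+ 2 = Theta0 j k ^+ 2.
  by rewrite !mxE Tkj T0kj sub0r sqrrN.
rewrite e1 e2; move: n1 n2 n3 sq; lra.
Qed.

Unset Implicit Arguments.
Theorem theorem3 (R : realType) (d : measure_display) (T : measurableType d)
  (P : probability T R) (n p q : nat)
  (E0 : {set {set 'I_p}}) (Theta0 : 'M[R]_p) (X : 'I_n -> 'I_p -> T -> R)
  (gamma eps1 C lmax theta0 : R) :
  (1 < n)%N -> (2 <= p)%N -> (0 < q)%N ->
  edge_set E0 -> posdef Theta0 -> support_is E0 Theta0 ->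
  iid_gaussian P (invmx Theta0) X ->
  (* theta0 = min over edges {j,k} of E0 of |Theta0_jk| *)
  (exists j k : 'I_p, [/\ j != k, [set j; k]%SET \in E0 & theta0 = `|Theta0 j k|]) ->
  (forall j k : 'I_p, j != k -> [set j; k]%SET \in E0 -> theta0 <= `|Theta0 j k|) ->
  (* lmax = largest eigenvalue of Theta0 *)
  eigenvalue Theta0 lmax ->
  (forall a : R, eigenvalue Theta0 a -> a <= lmax) ->
  0 < eps1 ->
  sigma2max Theta0 * lmax <= C ->
  let kappa := ln p%:R / ln n%:R in
  let gamma0 := gamma - (1 - (4 * kappa)^-1) in
  (p%:R + 2 * q%:R) * ln p%:R / n%:R * (lmax ^+ 2 / theta0 ^+ 2)
    <= (3200 * Num.max (1 + gamma0) ((1 + eps1 / 2) * C ^+ 2))^-1 ->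
  exists A : set T, [/\ measurable A,
    A `<=` [set t | forall E : {set {set 'I_p}},
               edge_set E -> ~~ (E0 \subset E) -> (#|E| <= q)%N ->
               ((loglik X t Theta0)%:E - max_loglik X t E
                  > (2 * q%:R * ln p%:R * (1 + gamma0))%:E)%E] &
    (P A >= (1 - (Num.sqrt (pi * ln p%:R))^-1 * (p%:R `^ (- eps1)))%:E)%E].
Proof.
move=> n1 p2 q0 E0e T0pos T0supp iid [j0 [k0 [jk0 jkE0 th0E]]] thmin lmaxE lmaxP eps0 sC.
move=> kappa gamma0; rewrite (_ : 3200 = 50 * 64); last by rewrite -natrM.
move=> H.
have n0 : 0 < n%:R :> R by rewrite ltr0n; apply: leq_ltn_trans n1.
have p0 : (0 < p)%N by apply: leq_trans p2.
set L := ln p%:R in H *; have L0 : 0 < L by rewrite ln_gt0// ltr1n.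
have th0 : 0 < theta0 by rewrite th0E normr_gt0; apply/(T0supp.2 _ _ jk0).
have [B [C' [BC CB T0E frobC offdiag]]] := posdef_whitening T0pos lmaxP.
have T0BB : Theta0 *m (B *m B^T) = 1%:M.
  by rewrite T0E -mulmxA (mulmxA C') CB mul1mx -trmx_mul BC trmx1.
have SigmaE : invmx Theta0 = B *m B^T.
  have [T0u _] := mulmx1_unit T0BB.
  by rewrite -[RHS]mul1mx -(mulVmx T0u) -mulmxA T0BB mulmx1.
set sigma := sigma2max Theta0 in sC *.
have sigmaP j : (B *m B^T) j j <= sigma.
  by rewrite /sigma /sigma2max SigmaE; exact: (le_bigmax _ (fun j => (B *m B^T) j j)).
have diag0 j : 0 <= (B *m B^T) j j.
  by rewrite mxE sumr_ge0// => i _; rewrite mxE -expr2 sqr_ge0.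
have sigma0 : 0 <= sigma by exact: le_trans (diag0 j0) (sigmaP j0).
(* Row [j0] of [B] is sent by [C] to a unit vector, and [C] multiplies squared norms by at most
   [lmax]. This yields [lmax > 0], then [sigma lmax >= 1] and [C >= 1]. *)
have one_le : 1 <= lmax * (B *m B^T) j0 j0.
  have := frobC _ (row j0 B); rewrite -row_mul BC.
  rewrite /frob !big_ord1 (bigD1 j0)//= big1 ?addr0; last first.
    by move=> i /negPf ij0; rewrite !mxE eq_sym ij0 expr0n.
  rewrite !mxE eqxx expr1n => hle; rewrite (eq_bigr (fun i => (row j0 B) 0 i ^+ 2))//.
  by move=> i _; rewrite !mxE expr2.
have lmax0 : 0 < lmax.
  rewrite ltNge; apply/negP => l0; have := le_trans one_le (mulr_le0_ge0 l0 (diag0 j0)).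
  by rewrite ler10.
have sl1 : 1 <= sigma * lmax.
  by apply: le_trans one_le _; rewrite mulrC ler_wpM2r// ltW.
have th_half : theta0 <= lmax / 2 by rewrite th0E offdiag.
set h := theta0 ^+ 2 / lmax ^+ 2 in H *.
have h0 : 0 < h by rewrite divr_gt0// exprn_gt0.
have h4 : h <= 1 / 4.
  rewrite ler_pdivrMr ?exprn_gt0//.
  have : theta0 ^+ 2 <= (lmax / 2) ^+ 2 by rewrite lerXn2r ?nnegrE ?divr_ge0// ltW.
  by rewrite expr_div_n; lra.
set mx := Num.max _ _ in H.
have mx1 : 1 + gamma0 <= mx by rewrite le_max lexx.
have mx2 : (1 + eps1 / 2) * C ^+ 2 <= mx by rewrite le_max lexx orbT.
have C1 : 1 <= C by exact: le_trans sC.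
have mx0 : 0 < mx.
  by apply: lt_le_trans mx2; rewrite mulr_gt0 ?exprn_gt0//; lra.
pose s : R := p%:R; pose qr : R := q%:R; pose k := s + 2 * qr.
have s2 : 2 <= s by rewrite /s ler_nat.
have qr1 : 1 <= qr by rewrite /qr ler1n.
have kpos : 0 < k by rewrite /k; lra.
pose rho := k * L / n%:R.
have rho0 : 0 < rho by rewrite divr_gt0// mulr_gt0.
have H3200 : 50 * 64 * mx * rho <= h.
  by apply: signal_rescale => //; rewrite !mulr_gt0.
clear H.
(* Chosen so that [n tau ^ 2 / 32] is [(6 + eps1) log p] for the entries and
   [(2 q + 3 + eps1) log p] for the residuals, the exponents in [failure_bound]. *)
pose tau1 := Num.sqrt (32 * (6 + eps1) * L / n%:R).
pose tau2 := Num.sqrt (32 * (2 * qr + 3 + eps1) * L / n%:R).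
have t1E : tau1 ^+ 2 = 32 * (6 + eps1) * L / n%:R.
  by rewrite sqr_sqrtr// divr_ge0 ?ltW// mulr_gt0//; lra.
have t2E : tau2 ^+ 2 = 32 * (2 * qr + 3 + eps1) * L / n%:R.
  by rewrite sqr_sqrtr// divr_ge0 ?ltW// mulr_gt0//; lra.
have tau10 : 0 <= tau1 by exact: sqrtr_ge0.
have tau20 : 0 <= tau2 by exact: sqrtr_ge0.
have budget_hyp : 50 * 64 * ((1 + eps1 / 2) * C ^+ 2) * (k * L / n%:R) <= h.
  by apply: le_trans H3200; rewrite ler_wpM2r ?(ltW rho0)// ler_wpM2l.
have [t1le t2le budget] := noise_budget qr1 s2 L0 n0 lmax0 th0 eps0 sigma0 sl1 sC
  t1E t2E budget_hyp h4.
have tau_le1 (u : R) : 0 <= u -> u ^+ 2 <= 1 -> 0 <= u <= 1.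
  by move=> u0 u2; rewrite u0/= -(ger0_norm u0) -sqrtr_sqr -[leRHS]sqrtr1 ler_wsqrtr.
have n0' : (0 < n)%N by apply: leq_ltn_trans n1.
have iidB : iid_gaussian P (B *m B^T) X by rewrite -SigmaE.
pose F := {ffun 'I_q -> 'I_p * 'I_p}.
(* The projection is chosen for each code [f], independently of the sample point, so the tail bound
   applies to [Theta0 - N f] as to a fixed matrix. *)
have /choice[N NP] : forall f : F, exists N : 'M[R]_p, [/\ N^T = N,
    forall j k, ~~ support_rel f j k -> N j k = 0 &
    forall A : 'M[R]_p, A^T = A -> (forall j k, ~~ support_rel f j k -> A j k = 0) ->
      frob (B^T *m (A - Theta0) *m B) =
      frob (B^T *m (A - N) *m B) + frob (B^T *m (Theta0 - N) *m B)].
  move=> f; exact: model_projection (support_rel_sym f).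
pose sg (b : bool) : R := (-1) ^+ b.
have sg2 b : sg b ^+ 2 = 1 by rewrite /sg sqrr_sign.
pose M1 (x : 'I_p * 'I_p * bool) : 'M[R]_p :=
  sg x.2 *: (2^-1 *: (delta_mx x.1.1 x.1.2 + delta_mx x.1.2 x.1.1)).
have M1s x : (M1 x)^T = M1 x.
  apply/matrixP => a b; rewrite !mxE; congr (_ * (_ * _)).
  by rewrite addrC andbC; congr (_ + _); rewrite andbC.
have M2s f : (Theta0 - N f)^T = Theta0 - N f.
  by have [Ns _ _] := NP f; rewrite linearB/= Ns T0pos.1.
pose bad (tau : R) (M : 'M[R]_p) :=
  [set t | tau * Num.sqrt (frob (B^T *m M *m B)) < deviation X B M t].
have bad1 x := deviation_tail n0' BC CB iidB (M1s x) (tau_le1 _ tau10 t1le).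
have bad2 f := deviation_tail n0' BC CB iidB (M2s f) (tau_le1 _ tau20 t2le).
have [mU1 PU1] := measure_bigsetU_le_card (fun x => (bad1 x).1) (fun x => (bad1 x).2).
have [mU2 PU2] := measure_bigsetU_le_card (fun f => (bad2 f).1) (fun f => (bad2 f).2).
set U1 := \big[_/_]_i _ in mU1 PU1; set U2 := \big[_/_]_i _ in mU2 PU2.
(* The good event: no signed entry and no residual [Theta0 - N f] exceeds its threshold. *)
exists (~` (U1 `|` U2)); split.
- by apply: measurableC; exact: measurableU.
- move=> t /= tU E Ee EE0 Eq.
  have g1 x : deviation X B (M1 x) t <= tau1 * Num.sqrt (frob (B^T *m M1 x *m B)).
    rewrite leNgt; apply/negP => tx; apply: tU; left; rewrite /U1 -bigcup_seq.
    by exists x => //=; exact: mem_index_enum.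
  have g2 f : deviation X B (Theta0 - N f) t <=
      tau2 * Num.sqrt (frob (B^T *m (Theta0 - N f) *m B)).
    rewrite leNgt; apply/negP => tx; apply: tU; right; rewrite /U2 -bigcup_seq.
    by exists f => //=; exact: mem_index_enum.
  have [f fE] := edge_set_support p0 Ee Eq.
  have [Ns N0 pyth] := NP f.
  pose W := sample_cov X t - B *m B^T.
  have Wd j k1 : `|W j k1| <= tau1 * sigma.
    have bound b : sg b * W j k1 <= tau1 * sigma.
      have := g1 (j, k1, b); rewrite /M1/= deviation_entry => /le_trans; apply.
      rewrite ler_wpM2l// -(ger0_norm sigma0) -sqrtr_sqr ler_wsqrtr//.
      apply: le_trans (frob_entry B _ _ (sg2 b)) _.
      by rewrite expr2 ler_pM.
    have := bound false; have := bound true.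
    by rewrite /sg expr1 expr0 mul1r mulN1r ler_norml => h1 h2; apply/andP; split; lra.
  (* The radius [sqrt 2 theta0 / lmax]: the squared distance [2 theta0 ^ 2] forced by a missing edge
     loses a factor [lmax ^ 2] under whitening. From [h <= 1 / 4] it follows that [r <= 3 / 4]. *)
  pose r := Num.sqrt (2 * h).
  have r2 : r ^+ 2 = 2 * h by rewrite sqr_sqrtr// mulr_ge0// ltW.
  have r0 : 0 < r by rewrite sqrtr_gt0 mulr_gt0.
  have r34 : r <= 3 / 4.
    rewrite -[leRHS]ger0_norm// -sqrtr_sqr ler_wsqrtr//; lra.
  have gap Theta : in_model E Theta ->
      loglik X t Theta <= loglik X t Theta0 - n%:R * h / 20.
    move=> TE; have [Tpos T0] := TE.
    have Tsupp j k1 : ~~ support_rel f j k1 -> Theta j k1 = 0.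
      move=> fjk; apply: T0; first by apply: contra fjk => jk; rewrite /support_rel jk.
      apply: contra fjk => jkE; have [<-|jk] := eqVneq j k1; first by rewrite /support_rel eqxx.
      exact: fE.
    have frobT : r ^+ 2 <= frob (B^T *m (Theta - Theta0) *m B).
      rewrite r2 /h mulrA ler_pdivrMr ?exprn_gt0// [leRHS]mulrC.
      apply: le_trans (frob_diff_ge E0e EE0 (ltW th0) T0pos TE thmin) _.
      exact: frob_congruence_le (ltW lmax0) BC frobC.
    have noise := noise_bound (ltW lmax0) (mulr_ge0 tau10 sigma0) tau20 BC frobC
      (card_support_rel f) N0 Tsupp Wd (g2 f) (pyth _ Tpos.1 Tsupp).
    have nu_le : Num.sqrt ((tau1 * sigma) ^+ 2 * (p + 2 * q)%:R * lmax ^+ 2 + tau2 ^+ 2)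
        <= r / 5.
      rewrite -[leRHS]ger0_norm ?divr_ge0 ?(ltW r0)// -sqrtr_sqr ler_wsqrtr//.
      rewrite natrD natrM; apply: le_trans budget _.
      by rewrite expr_div_n r2 -/h; lra.
    have noise' : - (r / 5 * Num.sqrt (frob (B^T *m (Theta - Theta0) *m B)))
        <= \tr (W *m (Theta - Theta0)).
      by apply: le_trans noise; rewrite lerN2 ler_wpM2r ?sqrtr_ge0.
    (* The gap is [r ^ 2 / 20 = h / 10]; the factor [n / 2] of the likelihood turns it into
       [n h / 20]. *)
    have gap0 : 0 <= r ^+ 2 / 4 - r / 5 * r.
      have -> : r ^+ 2 / 4 - r / 5 * r = r ^+ 2 / 20 by field.
      by rewrite divr_ge0 ?sqr_ge0.
    have r01 : 0 < r <= 3 / 4 by rewrite r0.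
    have := log_det_gap BC CB T0E Tpos r01 frobT gap0 noise'.
    have -> : r ^+ 2 / 4 - r / 5 * r = h / 10 by rewrite -[_ * r]mulrAC -expr2 r2; field.
    rewrite /loglik; move: (ln _ - _) (ln _ - _) => l0 l1 hl.
    have := ler_wpM2l (_ : 0 <= n%:R / 2) hl.
    rewrite divr_ge0 ?(ltW n0)// => /(_ isT); lra.
  (* The bound is uniform over the model, so it passes to the supremum whether or not a maximiser
     exists. *)
  have sup_le : (max_loglik X t E <= (loglik X t Theta0 - n%:R * h / 20)%:E)%E.
    by apply: ge_ereal_sup => _ [M ME <-]; rewrite lee_fin; exact: gap.
  have target : 2 * q%:R * L * (1 + gamma0) < n%:R * h / 20.
    have nh0 : 0 < n%:R * h by rewrite mulr_gt0.
    have [g0|g0] := leP (1 + gamma0) 0.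
      apply: (@le_lt_trans _ _ 0); last by rewrite divr_gt0.
      by rewrite mulr_ge0_le0// mulr_ge0 ?(ltW L0)// mulr_ge0.
    (* For [1 + gamma0 > 0] the target is at most [k L mx = n mx rho], which is at most
       [n h / 3200]. *)
    apply: (@le_lt_trans _ _ (k * L * mx)).
      apply: ler_pM; rewrite ?(ltW g0)//.
        by rewrite mulr_ge0 ?(ltW L0)// mulr_ge0.
      by rewrite ler_wpM2r ?(ltW L0)// /k -/qr lerDr; lra.
    have -> : k * L * mx = n%:R * (mx * rho) by rewrite /rho; field; rewrite gt_eqF.
    by rewrite -mulrA ltr_pM2l//; lra.
  apply: (@lt_le_trans _ _ (n%:R * h / 20)%:E); first by rewrite lte_fin.
  have := leeB (lexx (loglik X t Theta0)%:E) sup_le.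
  apply: le_trans; rewrite -EFinB lee_fin opprB addrCA subrr addr0.
  exact: lexx.
- rewrite probability_setC; last exact: measurableU.
  rewrite EFinB leeB//.
  apply: (le_trans (measureU2 P mU1 mU2)).
  apply: (le_trans (leeD PU1 PU2)).
  rewrite -EFinD lee_fin; apply: le_trans (failure_bound q p2 eps0).
  rewrite -/L t1E t2E.
  have e1 : n%:R * (32 * (6 + eps1) * L / n%:R) / 32 = (6 + eps1) * L.
    by field; rewrite gt_eqF.
  have e2 : n%:R * (32 * (2 * qr + 3 + eps1) * L / n%:R) / 32 = (2 * qr + 3 + eps1) * L.
    by field; rewrite gt_eqF.
  by rewrite e1 e2.
Qed.
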